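(* Let $\lambda$ be a singular cardinal such that $\square_\lambda$ holds and $\lambda^{<\operatorname{cf}(\lambda)}<\lambda^\lambda=\lambda^+$. Then there exists a homogeneous $\lambda^+$-Souslin tree which is moreover $\operatorname{cf}(\lambda)$-complete.
   Context: A $\square_\lambda$-sequence is a sequence $\langle C_\alpha:\alpha<\lambda^+\rangle$ such that for every limit $\alpha<\lambda^+$, $C_\alpha$ is a club subset of $\alpha$ with order type $\le\lambda$, and if $\beta$ is an accumulation point of $C_\alpha$ lying in $C_\alpha$ (i.e. $\beta\in C_\alpha$ and $\sup(C_\alpha\cap\beta)=\beta$) then $C_\beta=C_\alpha\cap\beta$; $\square_\lambda$ asserts that one exists. A tree is a poset $\langle T,<\rangle$ in which $x_\downarrow=\{y:y<x\}$ is well ordered for every $x$; the height of $x$ is $\operatorname{otp}(x_\downarrow)$, and $x^\uparrow=\{y:x<y\}$. The tree is homogeneous if $x^\uparrow$ and $y^\uparrow$ are isomorphic whenever $x,y$ have the same height. It is $\kappa$-complete if every chain of size $<\kappa$ is contained in $x_\downarrow$ for some $x\in T$. A $\lambda^+$-Souslin tree is a tree of height $\lambda^+$ in which no subset of size $\lambda^+$ is a chain or an antichain (an antichain being a set of pairwise incomparable elements). *)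

(* Defs.v *)
From Stdlib Require Import Relations Wellfounded.

Definition card_le (A B : Type) : Prop := exists f : A -> B, forall x y, f x = f y -> x = y.
Definition card_lt (A B : Type) : Prop := card_le A B /\ ~ card_le B A.
Definition card_eq (A B : Type) : Prop :=
  exists (f : A -> B) (g : B -> A), (forall x, g (f x) = x) /\ (forall y, f (g y) = y).

Definition strict_wellorder {A : Type} (r : A -> A -> Prop) : Prop :=
  (forall x y z, r x y -> r y z -> r x z) /\
  (forall x, ~ r x x) /\
  (forall x y, r x y \/ x = y \/ r y x) /\
  well_founded r.

Record WO : Type := MkWO {
  wo_car :> Type;
  wo_lt : wo_car -> wo_car -> Prop;
  wo_wf : strict_wellorder wo_lt }.

Definition wo_le (W : WO) (x y : W) : Prop := wo_lt W x y \/ x = y.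

Definition below (W : WO) (x : W) : Type := {y : W | wo_lt W y x}.

(** W is an (initial ordinal representing an) infinite cardinal *)
Definition is_infinite_cardinal (W : WO) : Prop :=
  card_le nat W /\ forall x : W, ~ card_le W (below W x).

Definition cofinal (W : WO) (X : W -> Prop) : Prop :=
  forall a : W, exists x, X x /\ wo_le W a x.

(** |A| < cf(W) : A is strictly smaller than every cofinal subset of W
    (cf(W) = least cardinality of a cofinal subset). *)
Definition lt_cf (W : WO) (A : Type) : Prop :=
  forall X : W -> Prop, cofinal W X -> card_lt A {x : W | X x}.

Definition singular_cardinal (W : WO) : Prop :=
  is_infinite_cardinal W /\
  exists X : W -> Prop, cofinal W X /\ card_lt {x : W | X x} W.

Definition is_successor_cardinal (L K : WO) : Prop :=
  card_lt L K /\ forall a : K, card_le (below K a) L.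

(** type whose cardinality is lambda^{< cf lambda}: pairs (A, f) with
    A a subset of L of size < cf(L) and f : A -> L *)
Definition small_powers (L : WO) : Type :=
  { p : { A : L -> Prop & ({x : L | A x} -> L) } | lt_cf L {x : L | projT1 p x} }.

Definition is_limit (K : WO) (a : K) : Prop :=
  (exists b, wo_lt K b a) /\ (forall b, wo_lt K b a -> exists c, wo_lt K b c /\ wo_lt K c a).

Definition acc_point (K : WO) (C : K -> Prop) (b : K) : Prop :=
  (exists g, wo_lt K g b) /\
  (forall g, wo_lt K g b -> exists d, C d /\ wo_lt K g d /\ wo_lt K d b).

Definition club_in (K : WO) (a : K) (C : K -> Prop) : Prop :=
  (forall b, C b -> wo_lt K b a) /\
  (forall b, wo_lt K b a -> exists g, C g /\ wo_le K b g) /\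
  (forall b, wo_lt K b a -> acc_point K C b -> C b).

Definition otp_le (K : WO) (C : K -> Prop) (L : WO) : Prop :=
  exists f : {x : K | C x} -> L,
    forall x y, wo_lt K (proj1_sig x) (proj1_sig y) -> wo_lt L (f x) (f y).

(** Square_lambda sequence indexed by K = lambda^+; C a b means b ∈ C_a *)
Definition square_seq (L K : WO) (C : K -> K -> Prop) : Prop :=
  forall a : K, is_limit K a ->
    club_in K a (C a) /\ otp_le K (C a) L /\
    (forall b, C a b -> acc_point K (C a) b ->
       forall g, C b g <-> (C a g /\ wo_lt K g b)).

Definition square (L K : WO) : Prop := exists C, square_seq L K C.

Definition is_tree {T : Type} (lt : T -> T -> Prop) : Prop :=
  (forall x y z, lt x y -> lt y z -> lt x z) /\
  (forall x, ~ lt x x) /\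
  (forall x, strict_wellorder (fun (u v : {y : T | lt y x}) => lt (proj1_sig u) (proj1_sig v))).

Definition order_iso {A B : Type} (ra : A -> A -> Prop) (rb : B -> B -> Prop) : Prop :=
  exists (f : A -> B) (g : B -> A),
    (forall x, g (f x) = x) /\ (forall y, f (g y) = y) /\
    (forall x y, ra x y <-> rb (f x) (f y)).

Definition height_is {T : Type} (lt : T -> T -> Prop) (K : WO) (x : T) (a : K) : Prop :=
  order_iso (fun (u v : {y : T | lt y x}) => lt (proj1_sig u) (proj1_sig v))
            (fun (u v : below K a) => wo_lt K (proj1_sig u) (proj1_sig v)).

Definition tree_height_is {T : Type} (lt : T -> T -> Prop) (K : WO) : Prop :=
  (forall x : T, exists a : K, height_is lt K x a) /\
  (forall a : K, exists x : T, height_is lt K x a).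

Definition is_chain {T : Type} (lt : T -> T -> Prop) (S : T -> Prop) : Prop :=
  forall x y, S x -> S y -> lt x y \/ x = y \/ lt y x.

Definition is_antichain {T : Type} (lt : T -> T -> Prop) (S : T -> Prop) : Prop :=
  forall x y, S x -> S y -> x <> y -> ~ lt x y /\ ~ lt y x.

Definition homogeneous {T : Type} (lt : T -> T -> Prop) (K : WO) : Prop :=
  forall (x y : T) (a : K), height_is lt K x a -> height_is lt K y a ->
    order_iso (fun (u v : {z : T | lt x z}) => lt (proj1_sig u) (proj1_sig v))
              (fun (u v : {z : T | lt y z}) => lt (proj1_sig u) (proj1_sig v)).

Definition cf_complete {T : Type} (lt : T -> T -> Prop) (L : WO) : Prop :=
  forall S : T -> Prop, is_chain lt S -> lt_cf L {x : T | S x} ->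
    exists x : T, forall y, S y -> lt y x.

Definition souslin_tree {T : Type} (lt : T -> T -> Prop) (K : WO) : Prop :=
  is_tree lt /\ tree_height_is lt K /\
  (forall S : T -> Prop, card_eq {x : T | S x} K ->
     ~ is_chain lt S /\ ~ is_antichain lt S).

(* Main.v *)
(** Under [2^lambda = lambda^+] the gaps of a square sequence guess every subset of [lambda^+]:
    for each [mu < lambda] there is a function [g] of consecutive points [d < c] of a club [C_a] such
    that every [Z] is predicted, as [Z] below some ordinal strictly between [d] and [c], in cofinally
    many gaps of some [C_a] with [cf a > mu]; this is Shelah's proof of diamond run on the gaps.

    Level [a] of the tree consists of all branches when [cf a < cf lambda].  Otherwise it is generated
    by branches climbing along [C_a], closed under replacing an initial segment by any node of the
    tree; this closure gives homogeneity, and the coherence of the square sequence lets the climb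
    pass limits.  At each gap the climb serves two guesses at a dense open set [D].  Serving the guess
    that belongs to the generator puts more and more translates of the branch into [D]: first any
    fewer than [lambda] of them, then, in [cf lambda] such rounds, all those by the nodes of one level.
    Serving the other guess, common to all generators, puts all translates by the nodes of the current
    level into [D] whenever possible.  So some level is included in [D], and antichains are bounded. *)

Require Import Defs.
From Corelib Require Import ssreflect.
From Stdlib Require Import Classical ClassicalEpsilon FunctionalExtensionality.
From Stdlib Require Import PropExtensionality Inverse_Image Inclusion Lexicographic_Product Relation_Operators Arith Lia Cantor.

Local Open Scope general_if_scope.
Local Notation "x << y" := (wo_lt _ x y) (at level 70).
Local Notation "x <<= y" := (wo_le _ x y) (at level 70).

(** Completeness and homogeneity both work against the Souslin property. Completeness puts every
    branch into the levels of cofinality below cf lambda, so nothing is sealed there; these levels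
    keep size lambda because lambda^{<cf lambda} = lambda. Homogeneity brings with each branch its
    translates by all lower nodes, so up to lambda nodes have to enter [D] together. But a club
    [C a] with cf a > cf lambda has fewer than lambda points, and a generator's own guess serves one
    index per gap. Hence the rounds along a cofinal subset of lambda, and hence a guessing function
    for each mu < lambda: with cf a > mu the mu successes of a climb are bounded below [a], while
    the good gaps are not. These long climbs only show that suitable nodes exist above any given
    node. Regularity of lambda^+ bounds where they exist, and since a guessed ordinal can be
    required to be closed under such a bound, they are found again inside a single gap. There the
    common guess can take them. It has to be common because one level [a] must work for all
    generators at once. *)

Lemma sig_eq {A} {P : A -> Prop} (x y : {a | P a}) : proj1_sig x = proj1_sig y -> x = y.
Proof. by case: x y => [x p] [y q] /= e; subst y; rewrite (proof_irrelevance _ p q). Qed.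

Lemma fun_choice {A} {B : A -> Type} (P : forall x, B x -> Prop) :
  (forall x, exists y, P x y) -> exists f : forall x, B x, forall x, P x (f x).
Proof.
move=> h; exists (fun x => proj1_sig (constructive_indefinite_description _ (h x))) => x.
exact: proj2_sig.
Qed.

(** * Cardinal comparisons *)

Lemma card_le_refl A : card_le A A.
Proof. by exists id. Qed.

Lemma card_le_trans A B C : card_le A B -> card_le B C -> card_le A C.
Proof. by move=> [f fi] [g gi]; exists (fun x => g (f x)) => x y /gi /fi. Qed.

Lemma card_le_prod A A' B B' : card_le A A' -> card_le B B' -> card_le (A * B) (A' * B').
Proof.
move=> [f fi] [g gi]; exists (fun p => (f (fst p), g (snd p))) => -[a b] [a' b'] /= [].
by move=> /fi -> /gi ->.
Qed.

Lemma card_le_sum A A' B B' : card_le A A' -> card_le B B' -> card_le (A + B) (A' + B').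
Proof.
move=> [f fi] [g gi].
exists (fun p => match p with inl a => inl (f a) | inr b => inr (g b) end) => -[a|b] [a'|b'] //= [].
  by move=> /fi ->.
by move=> /gi ->.
Qed.

Lemma surj_card_le A B (f : A -> B) : (forall b, exists a, f a = b) -> card_le B A.
Proof.
by move=> /fun_choice [g gP]; exists g => x y e; rewrite -(gP x) -(gP y) e.
Qed.

Lemma card_le_surj A B (a0 : A) :
  card_le A B -> exists f : B -> A, forall a, exists b, f b = a.
Proof.
move=> [f fi]; exists (fun b => epsilon (inhabits a0) (fun a => f a = b)) => a; exists (f a).
apply: fi; exact: (epsilon_spec (inhabits a0) (fun a' => f a' = f a) (ex_intro _ a eq_refl)).
Qed.

Lemma card_le_img A B (f : A -> B) : card_le {b | exists a, f a = b} A.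
Proof.
have /fun_choice [g gP] : forall b : {b | exists a, f a = b}, exists a, f a = proj1_sig b.
  by case.
by exists g => x y e; apply: sig_eq; rewrite -(gP x) -(gP y) e.
Qed.

Lemma card_le_sub {A} (P Q : A -> Prop) :
  (forall x, P x -> Q x) -> card_le {x | P x} {x | Q x}.
Proof.
move=> s; exists (fun x => exist _ (proj1_sig x) (s _ (proj2_sig x))) => x y [].
exact: sig_eq.
Qed.

Lemma card_le_sig {A} (P : A -> Prop) : card_le {x | P x} A.
Proof. by exists (@proj1_sig _ _) => x y /sig_eq. Qed.

Lemma nat2 : card_le (nat * nat) nat.
Proof. by exists to_nat => x y /(f_equal of_nat); rewrite !cancel_of_to. Qed.

(** The copy [i] of nat inside [B] is moved onto its odd members, which frees the even ones for the
    new summand; [k] is the partial inverse of [i]. *)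
Lemma nat_plus_absorb B : card_le nat B -> card_le (nat + B) B.
Proof.
move=> [i ii].
pose k (b : B) : option nat := match excluded_middle_informative (exists n, i n = b) with
  | left h => Some (proj1_sig (constructive_indefinite_description _ h)) | right _ => None end.
have k1 n : k (i n) = Some n.
  rewrite /k; case: excluded_middle_informative => [h|[]]; last by exists n.
  by case: constructive_indefinite_description => m /= /ii ->.
have k2 b : k b = None -> forall n, i n <> b.
  by rewrite /k; case: excluded_middle_informative => // h _ n e; apply: h; exists n.
have k3 b n : k b = Some n -> i n = b.
  rewrite /k; case: excluded_middle_informative => // h [<-].
  by case: constructive_indefinite_description.
exists (fun s => match s with inl n => i (2 * n)
  | inr b => match k b with Some n => i (2 * n + 1) | None => b end end).
move=> [n|b] [m|c].
- by move=> /ii e; f_equal; lia.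
- case e: (k c) => [m|] e'; first by move: e' => /ii; lia.
  by case: (k2 _ e _ e').
- case e: (k b) => [n|] e'; first by move: e' => /ii; lia.
  by case: (k2 _ e _ (eq_sym e')).
- case e: (k b) => [n|]; case e': (k c) => [n'|].
  + move=> /ii ?; have ?: n = n' by lia. subst; by rewrite -(k3 _ _ e) -(k3 _ _ e').
  + by move=> h; case: (k2 _ e' _ h).
  + by move=> h; case: (k2 _ e _ (eq_sym h)).
  + by move=> ->.
Qed.

(** * Well-founded recursion and choice *)

Lemma wf_least {A} (R : A -> A -> Prop) (P : A -> Prop) :
  well_founded R -> (exists x, P x) -> exists x, P x /\ forall y, R y x -> ~ P y.
Proof.
move=> wf [x px]; apply: NNPP => h; move: px; elim: (wf x) => {}x _ ih px.
by apply: h; exists x; split=> // y ryx /(ih _ ryx).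
Qed.

(** Recursion and choice in one. [Phi x] speaks about a total function, which keeps dependent types
    out of the applications; [loc] makes the default [b0] outside the initial segment harmless. *)
Lemma wf_choose {A B} (R : A -> A -> Prop) (b0 : B) (Phi : A -> (A -> B) -> B -> Prop) :
  well_founded R ->
  (forall x f g z, (forall y, R y x -> f y = g y) -> Phi x f z -> Phi x g z) ->
  (forall x f, (forall y, R y x -> Phi y f (f y)) -> exists z, Phi x f z) ->
  exists f, forall x, Phi x f (f x).
Proof.
move=> wf loc ex.
pose ext x (p : forall y, R y x -> B) y :=
  match excluded_middle_informative (R y x) with left h => p y h | right _ => b0 end.
pose F x (p : forall y, R y x -> B) := epsilon (inhabits b0) (Phi x (ext x p)).
pose f := Fix wf (fun _ => B) F.
have fE x : f x = F x (fun y _ => f y).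
  apply: (Fix_eq wf (fun _ => B) F) => {}x p q pq; rewrite /F; f_equal; f_equal.
  apply: functional_extensionality => y; rewrite /ext.
  by case: excluded_middle_informative.
exists f => x; elim: (wf x) => {}x _ ih.
have e y : R y x -> f y = ext x (fun y _ => f y) y.
  by rewrite /ext; case: excluded_middle_informative.
have [z hz] := ex x f ih.
apply: (loc x (ext x (fun y _ => f y))); first by move=> y /e.
rewrite fE /F; apply: epsilon_spec; exists z; exact: (loc x f).
Qed.

Lemma wf_inj {A B} (R : A -> A -> Prop) (b0 : B) :
  well_founded R -> (forall x y, x <> y -> R x y \/ R y x) ->
  (forall x (h : {y | R y x} -> B), exists b, forall y, h y <> b) -> card_le A B.
Proof.
move=> wf tot H.
have [||f fP] := wf_choose R b0 (fun x f z => forall y, R y x -> f y <> z) wf.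
- by move=> x f g z e h y ryx; rewrite -e //; apply: h.
- move=> x f _; have [b hb] := H x (fun y => f (proj1_sig y)); exists b => y r.
  exact: (hb (exist _ y r)).
- exists f => x y e; apply: NNPP => /tot [/fP|/fP] h; exact: h.
Qed.

(** * Well-orders *)

Section WellOrders.
Context {W : WO}.
Implicit Types x y z : W.

Lemma lt_trans x y z : x << y -> y << z -> x << z.
Proof. by case: (wo_wf W) => h _; apply: h. Qed.
Lemma lt_irr x : ~ x << x.
Proof. by case: (wo_wf W) => _ [h _]; apply: h. Qed.
Lemma lt_wf : well_founded (wo_lt W).
Proof. by case: (wo_wf W) => _ [_ [_ h]]. Qed.
Lemma lt_tot x y : x << y \/ x = y \/ y << x.
Proof. by case: (wo_wf W) => _ [_ [h _]]. Qed.
Lemma lt_or_le x y : x << y \/ y <<= x.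
Proof. by case: (lt_tot x y) => [|[->|]]; rewrite /wo_le; auto. Qed.
Lemma le_refl x : x <<= x. Proof. by right. Qed.
Lemma lt_le x y : x << y -> x <<= y. Proof. by left. Qed.
Lemma le_lt_trans x y z : x <<= y -> y << z -> x << z.
Proof. by case=> [|->] //; apply: lt_trans. Qed.
Lemma lt_le_trans x y z : x << y -> y <<= z -> x << z.
Proof. by move=> h [|<-] //; apply: lt_trans. Qed.
Lemma le_trans x y z : x <<= y -> y <<= z -> x <<= z.
Proof. by move=> h [h'|<-] //; left; apply: le_lt_trans h'. Qed.
Lemma le_not_lt x y : x <<= y -> ~ y << x.
Proof. by move=> h h'; apply: (lt_irr x); apply: le_lt_trans h'. Qed.
Lemma not_lt x y : ~ x << y -> y <<= x.
Proof. by case: (lt_or_le x y). Qed.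
Lemma not_le x y : ~ x <<= y -> y << x.
Proof. by case: (lt_or_le y x). Qed.
Lemma le_anti x y : x <<= y -> y <<= x -> x = y.
Proof. by case=> // h /le_not_lt. Qed.

Lemma least (P : W -> Prop) :
  (exists x, P x) -> exists x, P x /\ forall y, P y -> x <<= y.
Proof.
move=> /(wf_least _ _ lt_wf) [x [px h]]; exists x; split=> // y py.
by apply: not_lt => /h.
Qed.

Definition max_wo x y := if excluded_middle_informative (x <<= y) then y else x.
Lemma le_max_l x y : x <<= max_wo x y.
Proof. by rewrite /max_wo; case: excluded_middle_informative => // _; right. Qed.
Lemma le_max_r x y : y <<= max_wo x y.
Proof. by rewrite /max_wo; case: excluded_middle_informative => [_|/not_le]; [right|left]. Qed.
Lemma max_lt x y z : x << z -> y << z -> max_wo x y << z.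
Proof. by rewrite /max_wo; case: excluded_middle_informative. Qed.

Lemma below_le x y : x <<= y -> card_le (below W x) (below W y).
Proof. by move=> h; apply: card_le_sub => z /lt_le_trans; apply. Qed.

End WellOrders.

(* Pairs are ordered by their maximum first, so that every initial segment lies in a square. *)
Lemma godel_square (V : WO) :
  (forall (m : V) (h : {y | y <<= m} * {y | y <<= m} -> V), exists v, forall p, h p <> v) ->
  card_le (V * V) V.
Proof.
move=> H.
pose key (p : V * V) := (max_wo (fst p) (snd p), p).
pose R p q := slexprod V (V * V) (wo_lt V) (slexprod V V (wo_lt V) (wo_lt V)) (key p) (key q).
case: (classic (inhabited V)) => [[v0]|ni]; last first.
  by exists fst => -[x]; case: ni.
apply: (wf_inj R v0).
- apply: wf_inverse_image; do 2?[apply: wf_slexprod]; exact: lt_wf.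
- move=> [a b] [c d] ne; rewrite /R /key /=.
  case: (lt_tot (max_wo a b) (max_wo c d)) => [h|[->|h]].
  + by left; left.
  + case: (lt_tot a c) => [h|[e|h]]; [by left; right; left| |by right; right; left].
    subst c; case: (lt_tot b d) => [h|[e|h]]; [by left; right; right| |by right; right; right].
    by subst.
  + by right; left.
- move=> [a b] h; pose m := max_wo a b.
  have Rm p : R p (a, b) -> fst p <<= m /\ snd p <<= m.
    case: p => c d; rewrite /R /key /= => hl.
    have hm : max_wo c d <<= m.
      by inversion hl; subst; [left|rewrite /m; right].
    by split; [apply: le_trans (le_max_l c d) hm|apply: le_trans (le_max_r c d) hm].
  pose h' (p : {y | y <<= m} * {y | y <<= m}) :=
    let q := (proj1_sig (fst p), proj1_sig (snd p)) in
    match excluded_middle_informative (R q (a, b)) with left r => h (exist _ q r) | right _ => v0 end.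
  have [v hv] := H m h'; exists v => -[[c d] r] e.
  have [hc hd] := Rm _ r.
  apply: (hv (exist _ c hc, exist _ d hd)); rewrite /h' /=.
  case: excluded_middle_informative => // r'.
  by rewrite -e; f_equal; apply: sig_eq.
Qed.

Lemma nat_plus_wo (W : WO) : exists r, @strict_wellorder (nat + W) r /\
  (forall n x, ~ r (inr x) (inl n)) /\ (forall x y, r (inr x) (inr y) -> x << y).
Proof.
pose r (a b : nat + W) := match a, b with inl n, inl m => n < m | inl _, inr _ => True
  | inr _, inl _ => False | inr x, inr y => x << y end.
exists r; split; last by split=> [n x|x y] ?.
split; [|split; [|split]].
- move=> [a|a] [b|b] [c|c] //=; [lia|exact: lt_trans].
- move=> [a|a] /=; [lia|exact: lt_irr].
- move=> [a|a] [b|b] /=; auto.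
  + case: (Nat.lt_trichotomy a b) => [|[->|]]; auto.
  + case: (lt_tot a b) => [|[->|]]; auto.
- have wn n : Acc r (inl n).
    elim: (Wf_nat.lt_wf n) => {}n _ ih; constructor=> -[m /= /ih h|y []]; exact h.
  move=> [n|x]; first exact: wn.
  elim: (lt_wf x) => {}x _ ih; constructor=> -[m _|y /= /ih h]; [exact: wn|exact h].
Qed.

(** The copy of nat makes every segment infinite and so removes the finite case from the induction
    for Hessenberg's theorem; [nat_plus_absorb] takes it away again. *)
Definition aug (W : WO) (c : W) : Type := (nat + below W c)%type.

(** With nat placed before [W], every closed initial segment embeds into nat or into some [aug W c],
    so the square of such a segment cannot cover [nat + W]. *)
Lemma hessenberg_step (W : WO) :
  (forall c : W, card_le (aug W c * aug W c) (aug W c)) ->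
  (forall c : W, ~ card_le (nat + W) (aug W c)) ->
  card_le ((nat + W) * (nat + W)) (nat + W).
Proof.
move=> sq init.
case: (classic (card_le (nat + W) nat)) => [h|nn].
  apply: card_le_trans (card_le_prod _ _ _ _ h h) _.
  by apply: card_le_trans nat2 _; exists inl => x y [].
have [r [wr [r1 r2]]] := nat_plus_wo W.
apply: (godel_square (MkWO _ r wr)) => m h.
apply: NNPP => hn.
have hs : forall v : nat + W, exists p, h p = v.
  by move=> v; apply: NNPP => hv; apply: hn; exists v => p e; apply: hv; exists p.
have {hs} := surj_card_le _ _ h hs; case: m {h hn} => [k|c] hle.
- apply: nn; apply: card_le_trans hle _; apply: card_le_trans _ nat2.
  suff e : card_le {y : MkWO _ r wr | y <<= inl k} nat by apply: card_le_prod.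
  exists (fun y => match proj1_sig y with inl n => n | inr _ => 0 end).
  move=> [[x|x] hx] [[y|y] hy] /= e; apply: sig_eq => /=.
  + by rewrite e.
  + by case: hy => //= /r1.
  + by case: hx => //= /r1.
  + by case: hx => //= /r1.
- apply: (init c); apply: card_le_trans hle _; apply: card_le_trans _ (sq c).
  suff e : card_le {y : MkWO _ r wr | y <<= inr c} (aug W c) by apply: card_le_prod.
  have hc x : wo_le (MkWO _ r wr) (inr x) (inr c) -> x <> c -> x << c.
    by case=> [/r2|[]].
  exists (fun y => match y with
    | exist _ (inl n) _ => inl (S n)
    | exist _ (inr x) hx => match excluded_middle_informative (x = c) with
        left _ => inl 0 | right ne => inr (exist _ x (hc x hx ne)) end end).
  move=> [[x|x] hx] [[y|y] hy] //=.
  + by case=> e; apply: sig_eq => /=; rewrite e.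
  + by case: excluded_middle_informative.
  + by case: excluded_middle_informative.
  + case: excluded_middle_informative => ?; case: excluded_middle_informative => ? //; subst.
    * by move=> _; apply: sig_eq.
    * by case=> e; apply: sig_eq => /=; rewrite e.
Qed.

Lemma sub_wo (W : WO) (w : W) :
  @strict_wellorder (below W w) (fun x y => proj1_sig x << proj1_sig y).
Proof.
split; [|split; [|split]].
- by move=> x y z; apply: lt_trans.
- by move=> x; apply: lt_irr.
- move=> x y; case: (lt_tot (proj1_sig x) (proj1_sig y)) => [|[/sig_eq|]]; auto.
- apply: wf_inverse_image; exact: lt_wf.
Qed.

(** Either [aug W w] is no larger than an earlier [aug W c], or it exceeds all of them; then [w]
    acts as an initial ordinal and Gödel's ordering applies to the segment below it. *)
Lemma aug_square (W : WO) (w : W) : card_le (aug W w * aug W w) (aug W w).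
Proof.
elim: (lt_wf w) => {}w _ ih.
case: (classic (exists c, c << w /\ card_le (aug W w) (aug W c))) => [[c [cw h]]|hn].
  apply: card_le_trans (card_le_prod _ _ _ _ h h) _; apply: card_le_trans (ih c cw) _.
  by apply: card_le_sum; [exact: card_le_refl|apply: below_le; left].
pose V := MkWO _ _ (sub_wo W w).
have b1 c : card_le (aug V c) (aug W (proj1_sig c)).
  apply: card_le_sum; first exact: card_le_refl.
  exists (fun y : below V c => exist (fun z => z << proj1_sig c) (proj1_sig (proj1_sig y)) (proj2_sig y)).
  by move=> x y [] e; do 2!apply: sig_eq.
have b2 c : card_le (aug W (proj1_sig c)) (aug V c).
  apply: card_le_sum; first exact: card_le_refl.
  exists (fun y : below W (proj1_sig c) => exist (fun z : V => z << c)
     (exist (fun z => z << w) (proj1_sig y) (lt_trans _ _ _ (proj2_sig y) (proj2_sig c)))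
     (proj2_sig y)).
  by move=> x y [] e; apply: sig_eq.
apply: (hessenberg_step V) => c.
- apply: card_le_trans (card_le_prod _ _ _ _ (b1 c) (b1 c)) _.
  apply: card_le_trans (ih _ (proj2_sig c)) (b2 c).
- move=> h; apply: hn; exists (proj1_sig c); split; first exact: (proj2_sig c).
  exact: card_le_trans h (b1 c).
Qed.

Lemma below_square (W : WO) (w : W) :
  card_le nat (below W w) -> card_le (below W w * below W w) (below W w).
Proof.
move=> h; have i : card_le (below W w) (aug W w) by exists inr => x y [].
apply: card_le_trans (card_le_prod _ _ _ _ i i) _.
exact: card_le_trans (aug_square W w) (nat_plus_absorb _ h).
Qed.

(** The order that [f] induces on [A] is collapsed: [g x] is the least value not taken earlier. As
    [W] does not embed into [A], some [w] is missed, and then all values of [g] lie below [w]. *)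
Lemma card_le_bounded (W : WO) (A : Type) :
  (forall w : W, ~ card_le W (below W w)) ->
  card_le A W -> ~ card_le W A -> exists w, card_le A (below W w).
Proof.
move=> init [f fi] nle.
have wfA : well_founded (fun x y => f x << f y) by apply: wf_inverse_image; exact: lt_wf.
have hW x (h : A -> W) : exists b, forall y, f y << f x -> h y <> b.
  apply: NNPP => hn; apply: (init (f x)).
  apply: (card_le_trans _ {y | f y << f x}); last first.
    exists (fun y : {y | f y << f x} => exist (fun z => z << f x) (f (proj1_sig y)) (proj2_sig y)).
    by move=> y z [] /fi /sig_eq.
  apply: (surj_card_le _ _ (fun y : {y | f y << f x} => h (proj1_sig y))) => b.
  apply: NNPP => hb; apply: hn; exists b => y yx e; apply: hb.
  by exists (exist _ y yx).
have [w0|nw] := classic (inhabited W); last first.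
  by case: nle; exists (fun w => False_rect A (nw (inhabits w))) => w; case: nw.
case: w0 => w0.
pose Phi x (h : A -> W) b := (forall y, f y << f x -> h y <> b) /\
   (forall b', (forall y, f y << f x -> h y <> b') -> b <<= b').
have [||g gP] := wf_choose (fun x y => f x << f y) w0 Phi wfA.
- move=> x h g z e [h1 h2]; split=> [y yx|b' hb'].
    by rewrite -e //; apply: h1.
  by apply: h2 => y yx; rewrite e //; apply: hb'.
- by move=> x h _; have [b [hb1 hb2]] := least _ (hW x h); exists b.
- have gi x y : g x = g y -> x = y.
  move=> e; case: (lt_tot (f x) (f y)) => [h|[/fi //|h]].
    by case: (proj1 (gP y) x h e).
  by case: (proj1 (gP x) y h (eq_sym e)).
have [w hw] : exists w, forall x, g x <> w.
  apply: NNPP => hn; apply: nle; apply: (surj_card_le _ _ g) => b.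
  by apply: NNPP => hb; apply: hn; exists b => x e; apply: hb; exists x.
have gw x : g x << w.
  have hl : g x <<= w by apply: (proj2 (gP x)) => y _; apply: hw.
  by case: hl => // /hw.
by exists w; exists (fun x => exist (fun z => z << w) (g x) (gw x)) => x y [] /gi.
Qed.

Lemma nat_option B : card_le nat (option B) -> card_le nat B.
Proof.
move=> [f fi].
have [m hm] : exists m, forall k, exists b, f (m + k) = Some b.
  case: (classic (exists n, f n = None)) => [[n en]|h].
    exists (Datatypes.S n) => k; case e: (f (S n + k)) => [b|]; first by exists b.
    by have := fi _ _ (eq_trans e (eq_sym en)); lia.
  exists 0 => k; case e: (f (0 + k)) => [b|]; first by exists b.
  by case: h; exists k.
move: hm => /fun_choice [g gP]; exists g => x y e.
by have := fi (m + x) (m + y); rewrite !gP e => /(_ eq_refl); lia.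
Qed.

Lemma option_absorb B : card_le nat B -> card_le (option B) B.
Proof.
move=> h; apply: card_le_trans (nat_plus_absorb _ h).
by exists (fun o => match o with Some b => inr b | None => inl 0 end) => -[x|] [y|] // [->].
Qed.

Lemma le_option (W : WO) (w : W) : card_le {y | y <<= w} (option (below W w)).
Proof.
have hc x : x <<= w -> x <> w -> x << w by case.
exists (fun y => match excluded_middle_informative (proj1_sig y = w) with
  left _ => None | right ne => Some (exist (fun z => z << w) _ (hc _ (proj2_sig y) ne)) end).
move=> x y; case: excluded_middle_informative => ?; case: excluded_middle_informative => ? // e.
  by apply: sig_eq; congruence.
by apply: sig_eq; case: e.
Qed.

Lemma no_max (W : WO) : is_infinite_cardinal W -> forall a : W, exists b, a << b.
Proof.
move=> [inf init] a; apply: NNPP => hn.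
have h : card_le W (option (below W a)).
  apply: card_le_trans (le_option W a).
  have hl x : x <<= a by apply: not_lt => h; apply: hn; exists x.
  by exists (fun x => exist _ x (hl x)) => x y [].
apply: (init a); apply: card_le_trans (h) _; apply: option_absorb; apply: nat_option.
exact: card_le_trans inf h.
Qed.

Lemma small_cofinal (L : WO) : singular_cardinal L -> exists (X : L -> Prop) (n0 : L),
  (forall a, exists x, X x /\ a << x) /\
  card_le {x | X x} (below L n0) /\ card_le nat (below L n0).
Proof.
move=> [inf [X [cof [le nle]]]].
have nm := no_max _ inf; case: inf => inf init.
have [n0 h0] := card_le_bounded _ _ init le nle.
have Xc a : exists x, X x /\ a << x.
  have [b ab] := nm a; have [x [Xx bx]] := cof b; exists x; split=> //; exact: lt_le_trans bx.
exists X, n0; split=> //; split=> //; apply: card_le_trans h0.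
(* [X] has no greatest element, so iterating [g] from [x0] embeds nat into [X]. *)
have [x0 Xx0] : exists x, X x by case: inf => i _; have [x []] := Xc (i 0); exists x.
move: (Xc) => /fun_choice [g gP].
pose s := nat_rect (fun _ => L) x0 (fun _ => g).
have sX n : X (s n) by case: n => //= n; case: (gP (s n)).
have sm n k : s n << s (S n + k).
  elim: k => [|k ih]; first by rewrite Nat.add_0_r; case: (gP (s n)).
  by rewrite Nat.add_succ_r; apply: lt_trans ih _; case: (gP (s (S n + k))).
exists (fun n => exist _ (s n) (sX n)) => n m [e].
case: (Nat.lt_trichotomy n m) => [h|[//|h]].
  by have := sm n (m - S n); replace (S n + (m - S n)) with m by lia; rewrite e => /lt_irr.
by have := sm m (n - S m); replace (S m + (n - S m)) with n by lia; rewrite e => /lt_irr.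
Qed.

(** * The successor cardinal *)

Definition small (L : WO) (A : Type) := exists q : L, card_le A (below L q).

(* The closure points of functions stand in for clubs. *)
Definition closed_under {K : WO} (j : K -> K) (e : K) := forall x, x << e -> j x << e.

(** For a limit [a] this is cf a > |q|. *)
Definition cf_gt {L K : WO} (a : K) (q : L) :=
  forall h : below L q -> K, (forall i, h i << a) -> exists b, b << a /\ forall i, h i <<= b.

(* [n0] stands in for [cf L]: an infinite bound, below [L], for the size of the cofinal set [X]. *)
Record setting (L K : WO) (X : L -> Prop) (n0 : L) : Prop := {
  st_init : forall w : L, ~ card_le L (below L w);
  st_cof : forall a, exists x, X x /\ a << x;
  st_small : card_le {x | X x} (below L n0);
  st_inf : card_le nat (below L n0);
  st_succ : is_successor_cardinal L K }.

Section Successor.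
Context {L K : WO} {X : L -> Prop} {n0 : L} (S : setting L K X n0).
Let init := st_init _ _ _ _ S.
Let Xcof := st_cof _ _ _ _ S.
Let n0inf := st_inf _ _ _ _ S.
Let HK := st_succ _ _ _ _ S.

Lemma small_not A : small L A -> ~ card_le L A.
Proof. by move=> [q hq] h; apply: (init q); apply: card_le_trans hq. Qed.

Lemma big_inf q : n0 <<= q -> card_le nat (below L q).
Proof. by move=> h; apply: card_le_trans n0inf _; apply: below_le. Qed.

Lemma small_prod A B : small L A -> small L B -> small L (A * B).
Proof.
move=> [q hq] [r hr]; pose s := max_wo n0 (max_wo q r); exists s.
have qs : q <<= s by exact: (le_trans _ _ _ (le_max_l q r) (le_max_r _ _)).
have rs : r <<= s by exact: (le_trans _ _ _ (le_max_r q r) (le_max_r _ _)).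
apply: card_le_trans (below_square _ _ (big_inf s (le_max_l _ _))).
apply: card_le_prod; [apply: card_le_trans hq _|apply: card_le_trans hr _]; exact: below_le.
Qed.

Lemma small_atmost (m : L) : small L {y | y <<= m}.
Proof.
have [b [_ mb]] := Xcof m; exists b; apply: card_le_sub => x h; exact: le_lt_trans mb.
Qed.

Lemma L_square : card_le (L * L) L.
Proof.
apply: godel_square => m h; apply: NNPP => hn.
apply: (small_not _ (small_prod _ _ (small_atmost m) (small_atmost m))).
apply: (surj_card_le _ _ h) => v; apply: NNPP => hv; apply: hn; exists v => p e.
by apply: hv; exists p.
Qed.

Lemma L_two : exists a b : L, a <> b.
Proof.
have [b [_ h]] := Xcof n0; exists n0, b => e; subst; exact: (lt_irr _ h).
Qed.

Lemma L_option : card_le (option L) L.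
Proof.
have [a [b ab]] := L_two; apply: card_le_trans L_square.
by exists (fun o => match o with Some x => (b, x) | None => (a, a) end) => -[x|] [y|] // [] //; congruence.
Qed.

(** * Regularity of lambda^+ and points of large cofinality *)

Lemma K_atmost (a : K) : card_le {y | y <<= a} L.
Proof.
apply: card_le_trans (le_option _ _) _; apply: card_le_trans L_option.
have [f fi] := proj2 HK a.
by exists (option_map f) => -[x|] [y|] //= [] /fi ->.
Qed.

(** Otherwise the sets of all [y <<= h a], at most lambda of them and each of size at most lambda,
    would cover [K]. *)
Lemma K_reg A (h : A -> K) : card_le A L -> exists b, forall a, h a << b.
Proof.
move=> hA; apply: NNPP => hn; apply: (proj2 (proj1 HK)).
have /fun_choice [g gP] : forall b, exists a, b <<= h a.
  move=> b; apply: NNPP => hb; apply: hn; exists b => a; apply: not_le => hab.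
  by apply: hb; exists a.
have /fun_choice [e eP] : forall a : A, exists e : {y | y <<= h a} -> L,
    forall x y, e x = e y -> x = y by move=> a; apply: K_atmost.
apply: card_le_trans L_square; apply: (card_le_trans _ (A * L)); last first.
  by apply: card_le_prod hA (card_le_refl _).
have tr (p : {a : A & {y | y <<= h a}}) (q : {a : A & {y | y <<= h a}}) :
  projT1 p = projT1 q -> e _ (projT2 p) = e _ (projT2 q) ->
  proj1_sig (projT2 p) = proj1_sig (projT2 q).
  by case: p q => [a y] [a' y'] /= ea; subst a' => /eP ->.
exists (fun b => (g b, e (g b) (exist _ b (gP b)))) => x y [h1 h2].
exact: (tr (existT _ (g x) (exist _ x (gP x))) (existT _ (g y) (exist _ y (gP y))) h1 h2).
Qed.

Lemma below_K (a : K) : card_le (below K a) L.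
Proof. exact: (proj2 HK). Qed.

Lemma K_reg_below (h : K -> K) (a : K) :
  exists b, a << b /\ forall x, x <<= a -> h x << b.
Proof.
have [b hb] := K_reg _ (fun x : {y | y <<= a} => max_wo a (h (proj1_sig x))) (K_atmost a).
exists b; split.
  exact: (le_lt_trans _ _ _ (le_max_l a _) (hb (exist (fun y => y <<= a) a (le_refl a)))).
move=> x xa; exact: (le_lt_trans _ _ _ (le_max_r _ _) (hb (exist _ x xa))).
Qed.

Lemma K_nomax (a : K) : exists b, a << b.
Proof. by have [b [h _]] := K_reg_below id a; exists b. Qed.

(** An unbounded image in [K] would by regularity always contain a value beyond any lambda earlier
    ones, and so give a copy of [K] in [A]. *)
Lemma lt_K_le_L A : card_le A K -> ~ card_le K A -> card_le A L.
Proof.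
move=> [f fi] nle.
case: (classic (exists a, forall x, f x << a)) => [[a ha]|hn].
  apply: card_le_trans (below_K a).
  by exists (fun x => exist _ (f x) (ha x)) => x y [] /fi.
have ex a : exists x, a <<= f x.
  apply: NNPP => h; apply: hn; exists a => x; apply: not_le => hx; apply: h; by exists x.
case: (classic (inhabited A)) => [[x0]|nA]; last first.
  exists (fun x => False_rect L (nA (inhabits x))) => x; case: nA; exact: inhabits.
case: nle; apply: (wf_inj (wo_lt K) x0); first exact: lt_wf.
  by move=> x y ne; case: (lt_tot x y) => [|[|]]; auto.
move=> a h.
have [b hb] := K_reg _ (fun y => f (h y)) (below_K a).
have [x bx] := ex b; exists x => y e; have := hb y; rewrite e; exact: le_not_lt.
Qed.

Lemma closed_unbounded (j : K -> K) a : exists e, closed_under j e /\ a << e.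
Proof.
move: (K_reg_below j) => /fun_choice [J JP].
pose s := nat_rect (fun _ => K) a (fun _ => J).
have nL : card_le nat L by apply: card_le_trans n0inf (card_le_sig _).
have [e [he1 he2]] := least _ (K_reg _ s nL).
exists e; split; last exact: (he1 0).
move=> x xe; have [n hn] : exists n, x <<= s n.
  apply: NNPP => h; apply: (le_not_lt _ _ (he2 x _) xe) => n; apply: not_le => hx.
  by apply: h; exists n.
apply: lt_trans (he1 (Datatypes.S n)); exact: (proj2 (JP (s n))).
Qed.

(** This supplies lambda points in a bounded interval, to be distributed over fewer than lambda
    gaps. *)
Lemma L_in_unbounded (Y : K -> Prop) (a : K) :
  (forall a, exists y, Y y /\ a << y) ->
  exists b, card_le L {y | Y y /\ a << y /\ y << b}.
Proof.
move=> unb.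
have [||f fP] := wf_choose (wo_lt L) a
   (fun x f z => (Y z /\ a << z) /\ forall y, y << x -> f y << z) lt_wf.
- by move=> x f g z e [h h']; split=> // y yx; rewrite -e //; apply: h'.
- move=> x f _; have [b hb] := K_reg _ (fun y : below L x => f (proj1_sig y)) (card_le_sig _).
  have [z [Yz hz]] := unb (max_wo a b); exists z; split; first split=> //.
    exact: (le_lt_trans _ _ _ (le_max_l _ _) hz).
  move=> y yx; apply: (lt_trans _ _ _ (hb (exist _ y yx))); exact: (le_lt_trans _ _ _ (le_max_r _ _) hz).
- have [b hb] := K_reg _ f (card_le_refl _); exists b.
  have fY x : Y (f x) /\ a << f x /\ f x << b by case: (fP x) => -[].
  exists (fun x => exist _ (f x) (fY x)) => x y [e].
  case: (lt_tot x y) => [h|[//|h]].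
    by have := proj2 (fP y) _ h; rewrite e => /lt_irr.
  by have := proj2 (fP x) _ h; rewrite e => /lt_irr.
Qed.

Lemma cf_gt_le (a : K) (q : L) A (h : A -> K) : cf_gt a q -> is_limit K a -> card_le A (below L q) ->
  (forall i, h i << a) -> exists b, b << a /\ forall i, h i <<= b.
Proof.
move=> cf [[c ca] _] hA ha.
case: (classic (inhabited A)) => [[i0]|nA]; last first.
  by exists c; split=> // i; case: nA.
have [f fs] := card_le_surj _ _ i0 hA.
have [|b [ba hb]] := cf (fun i => h (f i)); first by move=> i; apply: ha.
by exists b; split=> // i; case: (fs i) => k <-; apply: hb.
Qed.

(** The point [a] is the least ordinal with more than |q| closure points of [j] below it. Each
    smaller ordinal has at most |q| of them, so a cofinal map from |q| into [a] would leave only |q|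
    closure points below [a], by Hessenberg's theorem. *)
Lemma cf_gt_point q (j : K -> K) : n0 <<= q -> (forall x, x << j x) ->
  exists a, is_limit K a /\ closed_under j a /\ cf_gt a q.
Proof.
move=> /big_inf qinf jinc.
have [c0 _] : exists c : K, True.
  by case: (proj1 (proj1 HK)) => f _; exists (f n0).
have [b hb] := L_in_unbounded _ c0 (closed_unbounded j).
pose big a := ~ card_le {y | closed_under j y /\ y << a} (below L q).
have [a [ha hmin]] : exists a, big a /\ forall y, big y -> a <<= y.
  apply: least; exists b => h; apply: (init q); apply: card_le_trans hb _.
  by apply: card_le_trans h; apply: card_le_sub => y [? []].
have hsm y : y << a -> card_le {z | closed_under j z /\ z << y} (below L q).
  by move=> ya; apply: NNPP => /hmin /le_not_lt; apply.
have ex x : x << a -> exists e, closed_under j e /\ x << e /\ e << a.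
  move=> xa; apply: NNPP => hn; apply: ha.
  apply: card_le_trans (option_absorb _ qinf).
  apply: (card_le_trans _ (option {z | closed_under j z /\ z << x})); last first.
    by have [f fi] := hsm x xa; exists (option_map f) => -[u|] [v|] //= [] /fi ->.
  have hx y : closed_under j y /\ y << a -> y <> x -> closed_under j y /\ y << x.
    move=> [cy ya] ne; split=> //; case: (lt_tot y x) => [//|[//|xy]].
    by case: hn; exists y.
  exists (fun y => match excluded_middle_informative (proj1_sig y = x) with
    left _ => None | right ne => Some (exist (fun z => closed_under j z /\ z << x) _ (hx _ (proj2_sig y) ne)) end).
  move=> u v; case: excluded_middle_informative => ?; case: excluded_middle_informative => ? // e.
    by apply: sig_eq; congruence.
  by apply: sig_eq; case: e.
have cla : closed_under j a.
  by move=> x /ex [e [ce [xe ea]]]; apply: lt_trans ea; apply: ce.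
exists a; split; [split|split=> //].
- apply: NNPP => hn; apply: ha; have [f _] := qinf; exists (fun _ => f 0) => -[x hx].
  by case: hn; exists x; case: hx.
- by move=> x xa; exists (j x); split=> //; apply: cla.
- move=> h hh; apply: NNPP => hn; apply: ha.
  have /fun_choice [g gP] : forall y : {y | closed_under j y /\ y << a}, exists i, proj1_sig y << h i.
    move=> [y [cy ya]]; apply: NNPP => hy; apply: hn; exists y; split=> // i.
    by apply: not_lt => hi; apply: hy; exists i.
  have /fun_choice [e eP] : forall i, exists e : {z | closed_under j z /\ z << h i} -> below L q,
    forall u v, e u = e v -> u = v by move=> i; apply: hsm.
  apply: card_le_trans (below_square _ _ qinf).
  exists (fun y => (g y, e (g y) (exist _ (proj1_sig y) (conj (proj1 (proj2_sig y)) (gP y))))).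
  have tr (p r : {i : below L q & {z | closed_under j z /\ z << h i}}) :
    projT1 p = projT1 r -> e _ (projT2 p) = e _ (projT2 r) ->
    proj1_sig (projT2 p) = proj1_sig (projT2 r).
    by case: p r => [i y] [i' y'] /= ei; subst i' => /eP ->.
  move=> u v [h1 h2]; apply: sig_eq.
  exact: (tr (existT _ (g u) (exist _ (proj1_sig u) _)) (existT _ (g v) (exist _ (proj1_sig v) _)) h1 h2).
Qed.

End Successor.

(** * Guessing along the square sequence *)

Definition consec {K : WO} (D : K -> Prop) (d c : K) :=
  D d /\ D c /\ d << c /\ forall x, D x -> d << x -> x << c -> False.

(** [fst (g d c)] is the ordinal up to which the guess speaks. Its closure under [j] leaves room
    below it for the extensions that a gap is to receive. *)
Definition hits {L K : WO} (C : K -> K -> Prop) (g : K -> K -> K * (K -> L -> Prop))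
    (Z : K -> L -> Prop) (j : K -> K) (a : K) :=
  forall b, b << a -> exists d c, consec (C a) d c /\ b <<= d /\
    d << fst (g d c) /\ fst (g d c) << c /\ closed_under j (fst (g d c)) /\
    forall z v, snd (g d c) z v <-> z << fst (g d c) /\ Z z v.

Section Guess.
Context {L K : WO} {X : L -> Prop} {n0 : L} (S : setting L K X n0).
Context (C : K -> K -> Prop) (HC : square_seq L K C) (Hpow : card_eq (L -> L) K).
Let Xcof := st_cof _ _ _ _ S.
Let Xsmall := st_small _ _ _ _ S.
Let HK := st_succ _ _ _ _ S.

(** One ordinal [b] names the restrictions to [x] of all the lambda times lambda sets [W m t] at
    once: together they amount to a subset of lambda, and there are at most lambda^lambda = lambda^+
    of these. *)
Lemma coding : exists code : K -> K -> L -> L -> K -> L -> Prop,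
  forall (W : L -> L -> K -> L -> Prop) x, exists b, forall m t z v,
  code x b m t z v <-> z << x /\ W m t z v.
Proof.
have [pr pri] := L_square S.
have [l0 [l1 l01]] := L_two S.
have [f' [f [ff _]]] := Hpow.
have /fun_choice [i ii] : forall x : K, exists i : below K x -> L, forall u v, i u = i v -> u = v.
  by move=> x; exact: (below_K S).
pose key x m t z v := pr (pr (m, t), pr (i x z, v)).
exists (fun x b m t z v => exists h : z << x, f b (key x m t (exist _ z h) v) = l1) => W x.
pose phi l := if excluded_middle_informative
  (exists m t z v, l = key x m t z v /\ W m t (proj1_sig z) v) then l1 else l0.
exists (f' phi) => m t z v; rewrite ff /phi; split.
  move=> [h]; case: excluded_middle_informative => // -[m' [t' [z' [v' [e w]]]]] _.
  split=> //; move: e => /pri [/pri [e1 e2] /pri [/ii e3 e4]].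
  by subst m' t' v' z'.
move=> [h w]; exists h; case: excluded_middle_informative => // -[].
by exists m, t, (exist (fun z => z << x) z h), v.
Qed.

(** If the order type of [C a] were unbounded in lambda, choosing a point of [C a] for each member
    of [X] would give a cofinal subset of [a] of size at most |X|. *)
Lemma square_small (a : K) (q : L) : n0 <<= q -> is_limit K a -> cf_gt a q -> small L {x | C a x}.
Proof.
move=> n0q la cf; have [[C1 [C2 C3]] [[f fm] _]] := HC a la.
have fi x y : f x = f y -> x = y.
  move=> e; case: (lt_tot (proj1_sig x) (proj1_sig y)) => [/fm|[/sig_eq|/fm]] //; rewrite e => /lt_irr //.
case: (classic (exists w, forall x, f x << w)) => [[w hw]|hn].
  exists w; exists (fun x => exist (fun z => z << w) (f x) (hw x)).
  by move=> x y [] /fi.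
have /fun_choice [g gP] : forall m : {x | X x}, exists x, proj1_sig m <<= f x.
  move=> [m Xm] /=; apply: NNPP => h; apply: hn; exists m => x; apply: not_le => hx.
  by apply: h; exists x.
have hA : card_le {x | X x} (below L q).
  by apply: card_le_trans Xsmall _; apply: below_le.
have [|b [ba hb]] := cf_gt_le a q _ (fun m => proj1_sig (g m)) cf la hA.
  by move=> m; apply: C1; apply: (proj2_sig (g m)).
have [c [bc ca]] := proj2 la b ba.
have [x [Cx cx]] := C2 c ca; pose y := exist (C a) x Cx.
have [m [Xm hm]] := Xcof (f y); pose m' := exist X m Xm.
have h1 : f (g m') << f y.
  by apply: fm; apply: le_lt_trans (hb m') _; apply: lt_le_trans cx.
case: (lt_irr (f y)); apply: lt_trans hm _.
exact: (le_lt_trans _ _ _ (gP m') h1).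
Qed.

(** Pigeonhole: lambda points of [E] lie between a point [c0] of [C a] and [J c0], and each is sent
    to the next point of [C a], which has fewer than lambda points. Closedness of [C a] provides the
    lower end [d] of the gap. *)
Lemma square_gap (a : K) (q : L) (E : K -> Prop) (J : K -> K) b :
  n0 <<= q -> is_limit K a -> cf_gt a q -> closed_under J a ->
  (forall x, card_le L {y | E y /\ x << y /\ y << J x}) -> b << a ->
  exists d c x y, consec (C a) d c /\ b <<= d /\ E x /\ E y /\ d << x /\ x << y /\ y <<= c.
Proof.
move=> n0q la cf clJ HJ ba.
have csm := square_small a q n0q la cf.
have [[C1 [C2 C3]] _] := HC a la.
have [c0 [Cc0 bc0]] := C2 b ba.
have Ja := clJ c0 (C1 _ Cc0).
pose Ys := {y | E y /\ c0 << y /\ y << J c0}.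
have /fun_choice [g gP] : forall y : Ys, exists c : {x | C a x}, proj1_sig y <<= proj1_sig c /\
    forall x, C a x -> proj1_sig y <<= x -> proj1_sig c <<= x.
  move=> [y [Ey [cy yJ]]].
  have [c [[Cc yc] hc]] := least (fun x => C a x /\ y <<= x) (C2 y (lt_trans _ _ _ yJ Ja)).
  by exists (exist _ c Cc); split=> //= x Cx yx; apply: hc.
have [y1 [y2 [lt12 e12]]] : exists y1 y2 : Ys, proj1_sig y1 << proj1_sig y2 /\ g y1 = g y2.
  apply: NNPP => hn; apply: (small_not S _ csm); apply: card_le_trans (HJ c0) _.
  exists g => x y e; case: (lt_tot (proj1_sig x) (proj1_sig y)) => [h|[/sig_eq //|h]].
    by case: hn; exists x, y.
  by case: hn; exists y, x.
have [y1c hc] := gP y1; have [y2c _] := gP y2; rewrite -e12 in y2c.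
case: (g y1) y1c hc y2c => c Cc /= y1c hc y2c {e12 gP g}.
case: y1 lt12 y1c hc => x [Ex [cx xJ]] /= lt12 y1c hc.
case: y2 lt12 y2c => y [Ey [cy yJ]] /= xy yc.
have ub z : C a z -> z << c -> z << x.
  move=> Cz zc; apply: not_le => xz; exact: (le_not_lt _ _ (hc z Cz xz) zc).
have [d [dub dl]] := least (fun d => forall z, C a z -> z << c -> z <<= d)
   (ex_intro _ x (fun z Cz zc => lt_le _ _ (ub z Cz zc))).
have dx : d <<= x by apply: dl => z Cz /(ub _ Cz) /lt_le.
have xc : x << c by apply: lt_le_trans yc.
have c0d : c0 <<= d by apply: dub => //; apply: lt_trans xc.
have Cd : C a d.
  apply: NNPP => nCd; apply: (nCd); apply: C3.
    by apply: le_lt_trans dx _; apply: lt_trans xJ Ja.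
  split; first by exists c0; case: c0d => // e; case: nCd; rewrite -e.
  move=> z zd; apply: NNPP => hn; apply: (le_not_lt _ _ (dl z _) zd) => w Cw wc.
  apply: not_lt => zw; apply: hn; exists w; split=> //; split=> //.
  by case: (dub w Cw wc) => // e; case: nCd; rewrite -e.
have dx' : d << x.
  case: dx => // e; subst d; case: (le_not_lt _ _ (hc x Cd (le_refl x)) xc).
exists d, c, x, y; split; [split=> //; split=> //; split|split=> //].
- exact: lt_trans xc.
- by move=> z Cz dz zc; apply: (le_not_lt _ _ (dub z Cz zc)).
- exact: le_trans c0d.
Qed.

(* Shelah's proof of diamond at a successor, run on the gaps of a square sequence. *)
Theorem guess q : n0 <<= q -> exists g, forall (Z : K -> L -> Prop) j,
  exists a, is_limit K a /\ cf_gt a q /\ hits C g Z j a.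
Proof.
move=> n0q; apply: NNPP => hn.
have /fun_choice [bad badP] : forall g : K -> K -> K * (K -> L -> Prop),
    exists p : (K -> L -> Prop) * (K -> K), forall a, is_limit K a -> cf_gt a q ->
    ~ hits C g (fst p) (snd p) a.
  move=> g; apply: NNPP => h; apply: hn; exists g => Z j; apply: NNPP => h'; apply: h.
  by exists (Z, j) => a la ca hh; apply: h'; exists a.
have [code codeP] := coding.
have l0 : L := n0.
have [k0 _] : exists c : K, True by case: (proj1 (proj1 HK)) => f _; exists (f n0).
have /fun_choice [e eP] : forall c : K, exists e : L -> K, forall x, x << c -> exists v, e v = x.
  move=> c; case: (classic (inhabited (below K c))) => [[x0]|hc].
    have [f fs] := card_le_surj _ _ x0 (below_K S c).
    exists (fun v => proj1_sig (f v)) => x xc.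
    by have [v ev] := fs (exist _ x xc); exists v; rewrite ev.
  exists (fun _ => k0) => x xc; case: hc; exact: (inhabits (exist _ x xc)).
pose B m c x := exists v, v << m /\ e c v = x.
pose now (P : L -> (K -> L -> Prop) * (K -> K)) m t (p : K * K) :=
  closed_under (snd (P t)) (fst p) /\
  forall z v, code (fst p) (snd p) m t z v <-> z << fst p /\ fst (P t) z v.
(* A candidate for stage [t] must be right about all earlier counterexamples; the guess is then the
   component [(m, t)] of what it codes. *)
pose V P m t d c (p : K * K) := d << fst p /\ fst p << c /\ B m c (fst p) /\ B m c (snd p) /\
  forall s, s << t -> now P m s p.
pose gof P m t d c := let p := epsilon (inhabits (k0, k0)) (V P m t d c) in
  (fst p, code (fst p) (snd p) m t).
have Vext P P' m t d c : (forall s, s << t -> P s = P' s) -> V P m t d c = V P' m t d c.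
  move=> h; apply: functional_extensionality => p; apply: propositional_extensionality.
  rewrite /V /now; split=> -[h1 [h2 [h3 [h4 h5]]]]; do 4!split=> //; move=> s st.
    by rewrite -h //; apply: h5.
  by rewrite h //; apply: h5.
(* [P m t] refutes the guessing function built from the [P m s] with [s << t]. The recursion is run
   for every [m], since the right [m] depends on [a], which is found only afterwards. *)
have /fun_choice [P PP] : forall m, exists P, forall t, P t = bad (gof P m t).
  { move=> m; have [||P PP] := wf_choose (wo_lt L) (bad (fun _ _ => (k0, fun _ _ => True)))
     (fun t P z => z = bad (gof P m t)) lt_wf.
  - move=> t P P' z h ->; f_equal; rewrite /gof.
    by do 2!apply: functional_extensionality => ?; rewrite (Vext P P').
  - by move=> t P _; exists (bad (gof P m t)).
  - by exists P. }
pose W m t z v := fst (P m t) z v.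
have /fun_choice [f fP] := codeP W.
(* A closure point of [J] is closed under the functions of all counterexamples, and it lies above
   the code [f x] of every smaller [x]. *)
have /fun_choice [J JP] : forall x, exists b, x << b /\ f x << b /\ forall m t, snd (P m t) x << b.
  move=> x.
  have [b hb] := K_reg S _ (fun p : L * L => snd (P (fst p) (snd p)) x) (L_square S).
  pose b' := max_wo (f x) (max_wo x b).
  have [b2 hb2] := K_nomax S b'.
  have h1 : max_wo x b << b2 := le_lt_trans _ _ _ (le_max_r _ _) hb2.
  exists b2; split; first exact: (le_lt_trans _ _ _ (le_max_l _ _) h1).
  split; first exact: (le_lt_trans _ _ _ (le_max_l _ _) hb2).
  move=> m t; apply: lt_trans (hb (m, t)) _; exact: (le_lt_trans _ _ _ (le_max_r _ _) h1).
have /fun_choice [J' J'P] : forall x, exists b, x << b /\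
    card_le L {y | closed_under J y /\ x << y /\ y << b}.
  move=> x; have [b hb] := L_in_unbounded S _ x
    (closed_unbounded S J).
  exists b; split=> //; case: hb => h _; case: (h l0) => y [_ [xy yb]]; exact: lt_trans yb.
have [a [la [cla cfa]]] := cf_gt_point S q J' n0q (fun x => proj1 (J'P x)).
(* The gap contains two closure points of [J]; the second one keeps the code [f x] of the first
   below [c]. *)
have gap b : b << a -> exists d c x m, consec (C a) d c /\ b <<= d /\
   d << x /\ x << c /\ closed_under J x /\ X m /\ B m c x /\ B m c (f x).
  { move=> ba; have [d [c [x [y [dc [bd [Ex [Ey [dx [xy yc]]]]]]]]]] :=
    square_gap a q _ J' b n0q la cfa cla (fun x => proj2 (J'P x)) ba.
  have xc : x << c by apply: lt_le_trans yc.
  have fc : f x << c.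
    have [_ [h _]] := JP x; apply: lt_trans h _; apply: lt_le_trans yc; exact: Ey.
  have [v1 ev1] := eP c x xc; have [v2 ev2] := eP c (f x) fc.
  have [m [Xm hm]] := Xcof (max_wo v1 v2).
  exists d, c, x, m; do 6!split=> //; last split.
  - by exists v1; split=> //; apply: (le_lt_trans _ _ _ (le_max_l _ _) hm).
  - by exists v2; split=> //; apply: (le_lt_trans _ _ _ (le_max_r _ _) hm). }
(* [X] has at most |q| < cf a members, so a single [m] serves cofinally many gaps. *)
have [m hm] : exists m, forall b, b << a -> exists d c x, consec (C a) d c /\ b <<= d /\
   d << x /\ x << c /\ closed_under J x /\ B m c x /\ B m c (f x).
  apply: NNPP => hm.
  have /fun_choice [h hP] : forall m : {m | X m}, exists b, b << a /\
     forall d c x, consec (C a) d c -> b <<= d ->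
       d << x -> x << c -> closed_under J x -> B (proj1_sig m) c x -> B (proj1_sig m) c (f x) -> False.
    move=> [m Xm]; apply: NNPP => h; apply: hm; exists m => b ba; apply: NNPP => h'; apply: h.
    exists b; split=> // d c x *; apply: h'; by exists d, c, x.
  have hA : card_le {x | X x} (below L q).
    by apply: card_le_trans Xsmall _; apply: below_le.
  have [b [ba hb]] := cf_gt_le a q _ h cfa la hA (fun m => proj1 (hP m)).
  have [d [c [x [m [dc [bd [dx [xc [Ex [Xm [B1 B2]]]]]]]]]]] := gap b ba.
  apply: (proj2 (hP (exist _ m Xm)) d c x dc _ dx xc Ex B1 B2).
  exact: (le_trans _ _ _ (hb _) bd).
have csm := square_small a q n0q la cfa.
have sm : small L (below L m) by exists m; apply: card_le_refl.
have big := small_prod S _ _ csm (small_prod S _ _ sm sm).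
(* Every [t] in [L] receives a candidate that is right before [t] and wrong at [t]. Different [t]
   thus have different candidates, but fewer than lambda candidates are available. *)
apply: (small_not S _ big).
pose dec (r : {x | C a x} * (below L m * below L m)) :=
  let c := proj1_sig (fst r) in (e c (proj1_sig (fst (snd r))), e c (proj1_sig (snd (snd r)))).
have /fun_choice [r rP] : forall t, exists r, (exists d, V (P m) m t d (proj1_sig (fst r)) (dec r)) /\
    ~ now (P m) m t (dec r).
  move=> t; have := badP (gof (P m) m t) a la cfa; rewrite -PP => nh.
  have [b [ba hb]] : exists b, b << a /\ forall d c, consec (C a) d c -> b <<= d ->
      V (P m) m t d c (epsilon (inhabits (k0, k0)) (V (P m) m t d c)) ->
      now (P m) m t (epsilon (inhabits (k0, k0)) (V (P m) m t d c)) -> False.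
    apply: NNPP => h; apply: nh => b ba; apply: NNPP => h'; apply: h; exists b; split=> //.
    move=> d c dc bd [dx [xc _]] [n1 n2]; apply: h'; by exists d, c.
  have [d [c [x [dc [bd [dx [xc [Ex [B1 B2]]]]]]]]] := hm b ba.
  (* The true code [(x, f x)] is right about every counterexample, so an admissible candidate exists
     and epsilon picks one. *)
  have Vx : V (P m) m t d c (x, f x).
    do 4!split=> //; move=> s _; split=> [y yx|z v] /=.
      by apply: lt_trans (Ex y yx); apply: (proj2 (proj2 (JP y))).
    exact: fP.
  have hV := epsilon_spec (inhabits (k0, k0)) _ (ex_intro _ _ Vx).
  have hN := hb d c dc bd hV; move: hV hN; case: (epsilon _ _) => x' b' hV hN.
  have [_ [_ [[v1 [vm1 e1]] [[v2 [vm2 e2]] _]]]] := hV.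
  exists (exist _ c (proj1 (proj2 dc)), (exist _ v1 vm1, exist _ v2 vm2)).
  rewrite /dec /= e1 e2; split=> //; by exists d.
exists r => t t' ett; case: (lt_tot t t') => [h|[//|h]].
  case: (rP t) => _; case; rewrite ett; case: (rP t') => -[d [_ [_ [_ [_ hh]]]]] _; exact: hh.
case: (rP t') => _; case; rewrite -ett; case: (rP t) => -[d [_ [_ [_ [_ hh]]]]] _; exact: hh.
Qed.

End Guess.

(** * The tree *)

Lemma pred_ext {A} (P Q : A -> Prop) : (forall x, P x <-> Q x) -> P = Q.
Proof.
by move=> h; apply: functional_extensionality => x; apply: propositional_extensionality.
Qed.

Lemma epsilon_ex {A} (a : A) (P : A -> Prop) : (exists x, P x) -> P (epsilon (inhabits a) P).
Proof. exact: epsilon_spec. Qed.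

Section Tree.
Context {L K : WO} {X : L -> Prop} {n0 : L} (S : setting L K X n0).
Context (C : K -> K -> Prop) (HC : square_seq L K C).
Context (gs : L -> K -> K -> K * (K -> L -> Prop)).
Context (small_pow : card_le (small_powers L) L).

(* A node of level a is a function K -> bool of which only the values below a matter. *)
Definition fn : Type := K -> bool.
Implicit Types (a b c d e z : K) (s t x : fn) (Lv : K -> fn -> Prop).

Definition agree a s t := forall z, z << a -> s z = t z.

(** The translate of [t] by [s]; on the tree it becomes the isomorphism between cones. *)
Definition splice b s t : fn := fun z => if excluded_middle_informative (z << b) then s z else t z.

Definition node_le (p q : K * fn) := fst p <<= fst q /\ agree (fst p) (snd p) (snd q).

Lemma agree_sym a s t : agree a s t -> agree a t s.
Proof. by move=> h z /h. Qed.
Lemma agree_trans a s t x : agree a s t -> agree a t x -> agree a s x.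
Proof. by move=> h h' z za; rewrite h // h'. Qed.
Lemma agree_le a b s t : b <<= a -> agree a s t -> agree b s t.
Proof. by move=> ba h z zb; apply: h; apply: lt_le_trans ba. Qed.

Lemma splice_lt b s t z : z << b -> splice b s t z = s z.
Proof. by rewrite /splice; case: excluded_middle_informative. Qed.
Lemma splice_ge b s t z : b <<= z -> splice b s t z = t z.
Proof. by rewrite /splice; case: excluded_middle_informative => // h /le_not_lt. Qed.
Lemma splice_agree b s t : agree b (splice b s t) s.
Proof. by move=> z zb; rewrite splice_lt. Qed.
Lemma splice_agree_r b a s t x : agree a t x -> agree a (splice b s t) (splice b s x).
Proof.
move=> h z za; case: (lt_or_le z b) => hz; first by rewrite !splice_lt.
by rewrite !splice_ge // h.
Qed.
Lemma splice_self b a s t : agree b s t -> agree a (splice b s t) t.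
Proof.
move=> h z _; case: (lt_or_le z b) => hz; last by rewrite splice_ge.
by rewrite splice_lt // h.
Qed.
Lemma splice_splice_le b c s t x : b <<= c -> agree c (splice b s t) x -> forall a,
  agree a (splice c x t) (splice b s t).
Proof.
move=> bc h a z _; case: (lt_or_le z c) => hz; first by rewrite splice_lt // h.
by rewrite !splice_ge //; apply: le_trans hz.
Qed.

Lemma node_le_refl p : node_le p p.
Proof. by split; [right|]. Qed.
Lemma node_le_trans p q r : node_le p q -> node_le q r -> node_le p r.
Proof.
move=> [h1 h2] [h3 h4]; split; first exact: le_trans h3.
by apply: agree_trans h2 _; apply: agree_le h4.
Qed.

(** Indexing each level by [L] turns a set of nodes into a relation on [K] and [L], which is what
    the square gaps guess. The choice is meaningful once the level is nonempty and of size at most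
    lambda. *)
Definition enumP (P : fn -> Prop) a : L -> fn :=
  epsilon (inhabits (fun _ _ => true))
    (fun p => (forall t, P t -> exists v, agree a (p v) t) /\ forall v, P (p v)).

Definition enum Lv a := enumP (Lv a) a.

(** Some initial segment of the node belongs to the set coded by [A]. *)
Definition sealed Lv (A : K -> L -> Prop) (p : K * fn) :=
  exists z, z <<= fst p /\ exists v, A z v /\ agree z (enum Lv z v) (snd p).

(* A generator works through all indices, or through the cofinal set [X] only. *)
Definition Xof (k : bool) (v : L) := match k with true => True | false => X v end.

Definition seals_level Lv d A (p : K * fn) :=
  forall s, Lv d s -> sealed Lv A (fst p, splice d s (snd p)).

Definition seals_upto Lv b A v (p : K * fn) :=
  forall u, u <<= v -> sealed Lv A (fst p, splice b (enum Lv b u) (snd p)).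

(** Only the least open index counts; if none is open, nothing is demanded. *)
Definition seals_next Lv b k A (p q : K * fn) :=
  forall v, Xof k v -> ~ seals_upto Lv b A v p ->
    (forall u, Xof k u -> u << v -> seals_upto Lv b A u p) -> seals_upto Lv b A v q.

Definition try_good Lv c (x : K) (Q : K * fn -> Prop) (p q : K * fn) :=
  node_le p q /\ Lv (fst q) (snd q) /\ fst q << x /\ fst q << c /\ Q q.

(** Falling back on [p] keeps the climb going at gaps where the guess is wrong. *)
Definition try Lv c (x : K) Q p : K * fn :=
  if excluded_middle_informative (exists q, try_good Lv c x Q p q)
  then epsilon (inhabits p) (try_good Lv c x Q p) else p.

(* The guess with the smaller ordinal is served first, so that serving it cannot spoil the other. *)
Definition try2 Lv c (x1 : K) Q1 (x2 : K) Q2 p :=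
  if excluded_middle_informative (x1 <<= x2)
  then try Lv c x2 Q2 (try Lv c x1 Q1 p) else try Lv c x1 Q1 (try Lv c x2 Q2 p).

(* (b, n, k): the translates by nodes of level b are treated, with the guesses [gs n], in the order
   of [Xof k]. *)
Definition par : Type := (K * L * bool)%type.

Definition step_mid Lv (p : par) d c y : K * fn :=
  let: (b, n, k) := p in
  let g1 := gs n0 d c in let g2 := gs n d c in
  try2 Lv c (fst g1) (seals_level Lv d (snd g1))
    (fst g2) (seals_next Lv b k (snd g2) (d, y)) (d, y).

Definition step Lv p d c y : fn :=
  epsilon (inhabits y) (fun t => Lv c t /\ agree (fst (step_mid Lv p d c y)) (snd (step_mid Lv p d c y)) t).

Definition is_last (D : K -> Prop) c d := D d /\ d << c /\ forall e, D e -> e << c -> e <<= d.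

Definition covers (D : K -> Prop) c z e := D e /\ e << c /\ z << e.

(** A step at [c] sees only the levels up to [c], so that a climb gives the same function whichever
    level it is computed for. *)
Definition restr c Lv : K -> fn -> Prop := fun b t => b <<= c /\ Lv b t.

Definition climb_step Lv (p : par) (D : K -> Prop) x b0 c (f : K -> fn) : fn :=
  if excluded_middle_informative (c <<= b0) then x
  else if excluded_middle_informative (exists d, is_last D c d)
  then step (restr c Lv) p (epsilon (inhabits c) (is_last D c)) c
         (f (epsilon (inhabits c) (is_last D c)))
  else fun z => f (epsilon (inhabits c) (covers D c z)) z.

Definition cut c x (f : K -> fn) : K -> fn :=
  fun e => if excluded_middle_informative (e << c) then f e else x.

Definition climb Lv p D x b0 : K -> fn :=
  Fix lt_wf (fun _ => fn) (fun c (f : forall e, e << c -> fn) =>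
    climb_step Lv p D x b0 c (fun e => match excluded_middle_informative (e << c) with
      | left h => f e h | right _ => x end)).

Lemma climb_eq Lv p D x b0 c :
  climb Lv p D x b0 c = climb_step Lv p D x b0 c (cut c x (climb Lv p D x b0)).
Proof.
apply: (Fix_eq lt_wf (fun _ => fn)) => {}c f g fg; f_equal.
by apply: functional_extensionality => e; case: excluded_middle_informative.
Qed.

Definition small_cof a := exists Y : K -> Prop, (forall y, Y y -> y << a) /\
  (forall b, b << a -> exists y, Y y /\ b <<= y) /\ lt_cf L {y | Y y}.

(** The start [b0] need not lie on the club and is added to its tail. *)
Definition from (D : K -> Prop) b0 : K -> Prop := fun e => e = b0 \/ (b0 << e /\ D e).

Definition branch Lv (p : par) a b0 v : fn := climb Lv p (from (C a) b0) (enum Lv b0 v) b0 a.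

Definition generated Lv a t := exists b1 s b0 v (p : par), b1 << a /\ b0 << a /\ fst (fst p) <<= b0 /\
  Lv b1 s /\ agree a t (splice b1 s (branch Lv p a b0 v)).

(** At zero, at successors and at limits of small cofinality the second clause is vacuous, and every
    function with the right restrictions is a node. *)
Definition level_spec Lv a t :=
  (forall b, b << a -> Lv b t) /\ (is_limit K a -> ~ small_cof a -> generated Lv a t).

Definition low a Lv : K -> fn -> Prop := fun b t => b << a /\ Lv b t.

Definition level : K -> fn -> Prop :=
  Fix lt_wf (fun _ => fn -> Prop) (fun a (f : forall b, b << a -> fn -> Prop) =>
    level_spec (fun b t => exists h : b << a, f b h t) a).

(** * Restriction, translation and enumeration of levels *)

Lemma levelE a : level a = level_spec (low a level) a.
Proof.
rewrite /level Fix_eq -/level.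
  move=> {}a f g fg; f_equal; apply: functional_extensionality => b; apply: pred_ext => t.
  by split=> -[h]; [rewrite fg|rewrite -fg] => ?; exists h.
f_equal; apply: functional_extensionality => b; apply: pred_ext => t.
by split=> -[h ?]; [|exists h].
Qed.

Lemma level_down a b t : b << a -> level a t -> level b t.
Proof. by rewrite levelE => ba [h _]; case: (h b ba). Qed.

Lemma level_le a b t : b <<= a -> level a t -> level b t.
Proof. by case=> [|->] //; apply: level_down. Qed.

Lemma level_ext a t t' : agree a t t' -> level a t -> level a t'.
Proof.
elim: (lt_wf a) t t' => {}a _ ih t t' h; rewrite levelE => -[h1 h2]; split.
  move=> b ba; split=> //; apply: (ih b ba t); last by case: (h1 b ba).
  by apply: agree_le h; left.
move=> la ca; have [b1 [s [b0 [v [p [h3 [h4 [h5 [h6 h7]]]]]]]]] := h2 la ca.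
exists b1, s, b0, v, p; do 4!split=> //; apply: agree_trans h7; exact: agree_sym.
Qed.

(** The generating data absorb the translation: the branch stays, and its replaced segment [s1]
    becomes [splice b s s1] or, if [b1 <<= b], just [s]. *)
Lemma level_splice a b s t : b <<= a -> level b s -> level a t -> level a (splice b s t).
Proof.
elim: (lt_wf a) b s t => {}a _ ih b s t [ba|->] ls lt; last first.
  apply: level_ext ls; apply: agree_sym; exact: splice_agree.
rewrite levelE; split.
  move=> e ea; split=> //; case: (lt_or_le e b) => h.
    apply: (level_ext e s); last exact: level_down ls.
    by apply: agree_sym; apply: agree_le (splice_agree b s t); left.
  by apply: ih => //; apply: level_down lt.
move=> la ca; move: (lt); rewrite levelE => -[_ /(_ la ca)].
move=> [b1 [s1 [b0 [v [p [h3 [h4 [h5 [[_ h6] h7]]]]]]]]].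
case: (lt_or_le b b1) => bb.
  exists b1, (splice b s s1), b0, v, p; do 3!split=> //; split.
    by split=> //; apply: ih => //; left.
  move=> z za; case: (lt_or_le z b) => zb.
    by rewrite !splice_lt //; apply: lt_trans bb.
  rewrite splice_ge // h7 //; case: (lt_or_le z b1) => zb1.
    by rewrite (splice_lt b1) // (splice_lt b1) // splice_ge.
  by rewrite !(splice_ge b1).
exists b, s, b0, v, p; do 4!split=> //.
move=> z za; case: (lt_or_le z b) => zb; first by rewrite !splice_lt.
by rewrite !splice_ge // h7 // splice_ge //; apply: le_trans zb.
Qed.

Definition inh a := exists t, level a t.

Definition level_card a := exists i : fn -> L, forall t t', level a t -> level a t' ->
  i t = i t' -> agree a t t'.

(** A single node of level [a] is enough, for its translate by [t] extends [t]. *)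
Lemma level_above a b t : inh a -> b <<= a -> level b t -> exists t', level a t' /\ agree b t t'.
Proof.
move=> [t' lt'] ba lt; exists (splice b t t'); split; first by apply: level_splice.
apply: agree_sym; exact: splice_agree.
Qed.

Lemma enum_spec a : inh a -> level_card a ->
  (forall t, level a t -> exists v, agree a (enum level a v) t) /\ forall v, level a (enum level a v).
Proof.
move=> [t0 lt0] [i ii]; rewrite /enum /enumP.
apply: (epsilon_ex (fun _ _ => true) (fun p : L -> fn =>
  (forall t, level a t -> exists v, agree a (p v) t) /\ forall v, level a (p v))).
exists (fun v => if excluded_middle_informative (exists t, level a t /\ i t = v)
  then epsilon (inhabits t0) (fun t => level a t /\ i t = v) else t0); split.
  move=> t lt; exists (i t); case: excluded_middle_informative => [h|[]]; last by exists t.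
  have [h1 h2] := epsilon_ex t0 _ h; exact: ii h2.
by move=> v; case: excluded_middle_informative => // h; case: (epsilon_ex t0 _ h).
Qed.

Lemma enum_restr c b : b <<= c -> enum (restr c level) b = enum level b.
Proof. by move=> h; rewrite /enum; f_equal; apply: pred_ext => t; split=> [[]|]. Qed.

Lemma enum_low a b : b << a -> enum (low a level) b = enum level b.
Proof. by move=> h; rewrite /enum; f_equal; apply: pred_ext => t; split=> [[]|]. Qed.

Lemma restr_low a c : c << a -> restr c (low a level) = restr c level.
Proof.
move=> ca; apply: functional_extensionality => b; apply: pred_ext => t; split=> -[h].
  by case.
by split=> //; split=> //; apply: le_lt_trans ca.
Qed.

Lemma try_le Lv c (x : K) Q p : fst p << c -> Lv (fst p) (snd p) ->
  node_le p (try Lv c x Q p) /\ fst (try Lv c x Q p) << c /\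
  Lv (fst (try Lv c x Q p)) (snd (try Lv c x Q p)).
Proof.
move=> pc lp; rewrite /try; case: excluded_middle_informative => h; last first.
  by split; first exact: node_le_refl.
by have [? [? [? []]]] := epsilon_ex p _ h.
Qed.

Lemma try2_le Lv c (x1 : K) Q1 (x2 : K) Q2 p : fst p << c -> Lv (fst p) (snd p) ->
  let q := try2 Lv c x1 Q1 x2 Q2 p in node_le p q /\ fst q << c /\ Lv (fst q) (snd q).
Proof.
move=> pc lp; rewrite /try2; case: excluded_middle_informative => _ /=.
  have [h1 [h2 h3]] := try_le Lv c x1 Q1 p pc lp.
  have [h4 [h5 h6]] := try_le Lv c x2 Q2 _ h2 h3.
  by split=> //; apply: node_le_trans h4.
have [h1 [h2 h3]] := try_le Lv c x2 Q2 p pc lp.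
have [h4 [h5 h6]] := try_le Lv c x1 Q1 _ h2 h3.
by split=> //; apply: node_le_trans h4.
Qed.

Lemma step_le p d c y : inh c -> d << c -> level d y ->
  let q := step_mid (restr c level) p d c y in
  node_le (d, y) q /\ fst q << c /\ level (fst q) (snd q) /\
  level c (step (restr c level) p d c y) /\
  agree (fst q) (snd q) (step (restr c level) p d c y).
Proof.
move=> ic dc ly q.
have [h1 [h2 h3]] : node_le (d, y) q /\ fst q << c /\ restr c level (fst q) (snd q).
  rewrite /q; case: p {q} => -[b n] k /=; apply: try2_le => //; split=> //; by left.
have lq : level (fst q) (snd q) by case: h3.
do 3!split=> //; rewrite /step -/q.
have [t [lt at_]] := level_above _ _ _ ic (lt_le _ _ h2) lq.
have /(epsilon_ex y) : exists t, restr c level c t /\ agree (fst q) (snd q) t.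
  by exists t; split=> //; split=> //; right.
by case=> -[].
Qed.

Lemma climb_ext Lv Lv' p D D' x b0 c : (forall e, e << c -> D e <-> D' e) ->
  (forall e t, e <<= c -> Lv e t <-> Lv' e t) ->
  climb Lv p D x b0 c = climb Lv' p D' x b0 c.
Proof.
elim: (lt_wf c) => {}c _ ih hD hLv; rewrite !climb_eq.
have -> : cut c x (climb Lv p D x b0) = cut c x (climb Lv' p D' x b0).
  apply: functional_extensionality => e; rewrite /cut; case: excluded_middle_informative => // ec.
  apply: ih => // [e' e'e|e' t e'e]; first by apply: hD; apply: lt_trans ec.
  by apply: hLv; left; apply: le_lt_trans ec.
have e1 : is_last D c = is_last D' c.
  apply: pred_ext => d; rewrite /is_last; split=> -[h1 [h2 h3]].
    by split; [apply/hD|split=> // e De ec; apply: h3 => //; apply/hD].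
  by split; [apply/hD|split=> // e De ec; apply: h3 => //; apply/hD].
have e2 z : covers D c z = covers D' c z.
  by apply: pred_ext => e; rewrite /covers; split=> -[h1 [h2 h3]]; split=> //; apply/hD.
have e3 : restr c Lv = restr c Lv'.
  apply: functional_extensionality => b; apply: pred_ext => t; rewrite /restr.
  by split=> -[h1 h2]; split=> //; apply/hLv.
rewrite /climb_step e1 e3.
case: excluded_middle_informative => // _; case: excluded_middle_informative => // _.
by apply: functional_extensionality => z; rewrite e2.
Qed.

(** No step is taken at a limit point [c], so agreement of the levels strictly below [c] suffices.
    This is the case needed when level [c] itself is defined from [low c level]. *)
Lemma climb_ext_limit Lv Lv' p D D' x b0 c : (forall e, e << c -> D e <-> D' e) ->
  (forall e t, e << c -> Lv e t <-> Lv' e t) -> ~ (exists d, is_last D c d) ->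
  climb Lv p D x b0 c = climb Lv' p D' x b0 c.
Proof.
move=> hD hLv nl; rewrite !climb_eq.
have -> : cut c x (climb Lv p D x b0) = cut c x (climb Lv' p D' x b0).
  apply: functional_extensionality => e; rewrite /cut; case: excluded_middle_informative => // ec.
  apply: climb_ext => [e' e'e|e' t e'e]; first by apply: hD; apply: lt_trans ec.
  by apply: hLv; apply: le_lt_trans ec.
have e1 : is_last D c = is_last D' c.
  apply: pred_ext => d; rewrite /is_last; split=> -[h1 [h2 h3]].
    by split; [apply/hD|split=> // e De ec; apply: h3 => //; apply/hD].
  by split; [apply/hD|split=> // e De ec; apply: h3 => //; apply/hD].
have e2 z : covers D c z = covers D' c z.
  by apply: pred_ext => e; rewrite /covers; split=> -[h1 [h2 h3]]; split=> //; apply/hD.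
rewrite /climb_step -e1; case: excluded_middle_informative => // _.
case: excluded_middle_informative => // _.
by apply: functional_extensionality => z; rewrite e2.
Qed.

(** * The climb stays in the tree *)

Section Branch.
Context (a b0 : K) (v : L) (p : par).
Hypothesis la : is_limit K a.
Hypothesis ha : forall b, b << a -> inh b.
Hypothesis b0a : b0 << a.
Hypothesis cb0 : level_card b0.
Hypothesis pb0 : fst (fst p) <<= b0.

Let D := from (C a) b0.
Let x := enum level b0 v.

Definition climb_at := climb (low a level) p D x b0.

Lemma branchE : branch (low a level) p a b0 v = climb_at a.
Proof. by rewrite /branch enum_low. Qed.

Lemma from_lt e : D e -> e << a.
Proof. by have [[C1 _] _] := HC a la; case=> [->|[_ /C1]]. Qed.

Lemma from_ge e : D e -> b0 <<= e.
Proof. by case=> [->|[]]; [right|left]. Qed.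

Lemma from_cofinal b : b << a -> exists e, D e /\ b << e.
Proof.
have [[C1 [C2 _]] _] := HC a la => ba.
have [c [bc ca]] := proj2 la _ (max_lt _ _ _ ba b0a).
have [e [Ce ce]] := C2 c ca; have h := lt_le_trans _ _ _ bc ce.
exists e; split; last exact: (le_lt_trans _ _ _ (le_max_l _ _) h).
right; split=> //; exact: (le_lt_trans _ _ _ (le_max_r _ _) h).
Qed.

(** [D] is closed: a supremum of its points below [c] that is itself below [c] belongs to [D], hence
    would be the last one. *)
Lemma no_last_limit c : D c \/ c = a -> b0 << c -> ~ (exists d, is_last D c d) ->
  forall b, b << c -> exists e, D e /\ e << c /\ b << e.
Proof.
move=> hc bc nl b bc'; apply: NNPP => hn; apply: nl.
have [[C1 [C2 C3]] _] := HC a la.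
have ub e : D e -> e << c -> e <<= b.
  by move=> De ec; apply: not_lt => be; apply: hn; exists e.
have [d [dub dl]] := least (fun d => forall e, D e -> e << c -> e <<= d) (ex_intro _ b ub).
have db : d <<= b by apply: dl.
have dc : d << c by apply: le_lt_trans bc'.
have Db0 : D b0 by left.
exists d; split=> //; apply: NNPP => nD; apply: (nD).
have b0d : b0 << d by case: (dub b0 Db0 bc) => // e; case: nD; rewrite -e.
have da : d << a.
  by case: hc => [/from_lt h|<-] //; apply: lt_trans h.
right; split=> //; apply: C3 => //; split; first by exists b0.
move=> g gd; apply: NNPP => hn2; apply: (le_not_lt _ _ (dl (max_wo g b0) _) (max_lt _ _ _ gd b0d)).
move=> e De ec; apply: not_lt => ge; apply: hn2; exists e.
have b0e := le_lt_trans _ _ _ (le_max_r _ _) ge.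
split; first by case: De => [h|[]] //; subst; case: (lt_irr _ b0e).
split; first exact: (le_lt_trans _ _ _ (le_max_l _ _) ge).
by case: (dub e De ec) => // h; case: nD; rewrite -h.
Qed.

Lemma climb_base : climb_at b0 = x.
Proof.
rewrite /climb_at climb_eq /climb_step; case: excluded_middle_informative => // -[]; by right.
Qed.

Lemma climb_succ c d : c << a -> b0 << c -> is_last D c d ->
  climb_at c = step (restr c level) p d c (climb_at d).
Proof.
move=> ca bc ld; rewrite /climb_at climb_eq /climb_step restr_low //.
case: excluded_middle_informative => [/le_not_lt //|_].
case: excluded_middle_informative => [h|[]]; last by exists d.
have h' := epsilon_ex c _ h; set d' := epsilon _ _.
have -> : d' = d.
  case: h' ld => [h1 [h2 h3]] [h4 [h5 h6]]; apply: le_anti; [exact: h6|exact: h3].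
rewrite /cut; case: excluded_middle_informative => // -[]; by case: ld => _ [].
Qed.

Lemma climb_union c : b0 << c -> ~ (exists d, is_last D c d) ->
  forall z e, D e -> e << c -> z << e -> exists e', D e' /\ e' << c /\ z << e' /\
    climb_at c z = climb_at e' z.
Proof.
move=> bc nl z e De ec ze; rewrite /climb_at climb_eq /climb_step.
case: excluded_middle_informative => [/le_not_lt //|_].
case: excluded_middle_informative => // _.
have [h1 [h2 h3]] := epsilon_ex c (covers D c z) (ex_intro _ e (conj De (conj ec ze))).
exists (epsilon (inhabits c) (covers D c z)); do 3!split=> //.
by rewrite /cut; case: excluded_middle_informative.
Qed.

Lemma climb_spec c : D c \/ c = a ->
  (forall b, b << c -> level b (climb_at c)) /\ (c << a -> level c (climb_at c)) /\
  (forall e, D e -> e <<= c -> agree e (climb_at e) (climb_at c)).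
Proof.
have [enum1 enum2] := enum_spec b0 (ha b0 b0a) cb0.
elim: (lt_wf c) => {}c _ ih hc.
have Db0 : D b0 by left.
have b0c : b0 <<= c by case: hc => [/from_ge|->] //; left.
case: b0c => [b0c|e]; last first.
  { subst c; rewrite climb_base; split; [|split] => [b bb0|_|e De eb0].
  - by apply: level_down (enum2 v).
  - exact: enum2.
  - by have -> : e = b0; [apply: le_anti => //; apply: from_ge|rewrite climb_base]. }
have wrap : (forall e, D e -> e << c -> agree e (climb_at e) (climb_at c)) ->
   forall e, D e -> e <<= c -> agree e (climb_at e) (climb_at c).
  by move=> h e De [|->] //; apply: h.
case: (classic (exists d, is_last D c d)) => [[d ld]|nl].
  have [Dd [dc dmax]] := ld.
  have ca : c << a.
    case: hc => [/from_lt //|e]; subst c.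
    by have [e [De /le_not_lt]] := from_cofinal d dc; case; apply: dmax => //; apply: from_lt.
  have [_ [/(_ (from_lt d Dd)) ld' agd]] := ih d dc (or_introl Dd).
  rewrite (climb_succ c d) //.
  have [[_ /= h1] [h2 [h3 [h4 h5]]]] := step_le p d c (climb_at d) (ha c ca) dc ld'.
  split; [|split] => // [b bc|]; first exact: level_down h4.
  rewrite -(climb_succ c d) // in h4 h5 *; apply: wrap => e De ec.
  have ed := dmax e De ec; apply: agree_trans (agd e De ed) _; apply: agree_le ed _.
  have [[hle _] _] := step_le p d c (climb_at d) (ha c ca) dc ld'.
  by apply: agree_trans h1 _; apply: agree_le h5.
have cof := no_last_limit c hc b0c nl.
have ag e : D e -> e << c -> agree e (climb_at e) (climb_at c).
  move=> De ec z ze; have [e' [De' [e'c [ze' ->]]]] := climb_union c b0c nl z e De ec ze.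
  case: (lt_or_le e e') => h.
    by have [_ [_ /(_ e De (lt_le _ _ h))]] := ih e' e'c (or_introl De'); apply.
  by have [_ [_ /(_ e' De' h)]] := ih e ec (or_introl De) => h'; rewrite h'.
have down b : b << c -> level b (climb_at c).
  move=> bc; have [e [De [ec be]]] := cof b bc.
  have [h _] := ih e ec (or_introl De); apply: level_ext (h b be).
  by apply: agree_le (ag e De ec); left.
split=> //; split; last exact: wrap.
move=> ca; rewrite levelE; split=> [b bc|lc nc]; first by split=> //; apply: down.
have Dc : D c by case: hc => // e; subst c; case: (lt_irr _ ca).
have Cc : C a c by case: Dc => [e|[]] //; subst c; case: (lt_irr _ b0c).
have [[C1 [C2 C3]] [_ coh]] := HC a la.
have accc : acc_point K (C a) c.
  split; first by exists b0.
  move=> g gc; have [e [De [ec ge]]] := cof _ (max_lt _ _ _ gc b0c); exists e.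
  have b0e := le_lt_trans _ _ _ (le_max_r _ _) ge.
  split; first by case: De => [h|[]] //; subst; case: (lt_irr _ b0e).
  by split=> //; exact: (le_lt_trans _ _ _ (le_max_l _ _) ge).
exists b0, x, b0, v, p; do 3!split=> //; split; first by split=> //; apply: enum2.
(* By coherence [C c] is the part of [C a] below [c], so the climb towards [a], stopped at [c], is
   the branch that the same data generate at level [c]. *)
have -> : branch (low c level) p c b0 v = climb_at c.
  rewrite /branch enum_low //; symmetry; apply: climb_ext_limit => // [e ec|e t ec].
    rewrite /D /from; have h := coh c Cc accc e; split=> -[->|[h1 h2]]; try by left.
      by right; split=> //; apply/h.
    by right; split=> //; case: (proj1 h h2).
  by rewrite /low; split=> -[_ h]; split=> //; apply: lt_trans ca.
apply: agree_sym; apply: splice_self; rewrite -{1}climb_base; exact: ag.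
Qed.

Lemma climb_top : level a (climb_at a) /\ agree b0 x (climb_at a).
Proof.
have [h1 [_ h2]] := climb_spec a (or_intror eq_refl).
have ag : agree b0 x (climb_at a).
  by have := h2 b0 (or_introl eq_refl) (lt_le _ _ b0a); rewrite climb_base.
split=> //; rewrite levelE; split=> [b ba|_ _]; first by split=> //; apply: h1.
have [_ enum2] := enum_spec b0 (ha b0 b0a) cb0.
exists b0, x, b0, v, p; do 3!split=> //; split; first by split=> //; apply: enum2.
by rewrite branchE; apply: agree_sym; apply: splice_self.
Qed.

End Branch.

(** * Every level is nonempty and of size at most lambda *)

Lemma card_le_LL A B : card_le A L -> card_le B L -> card_le (A * B) L.
Proof. by move=> hA hB; apply: card_le_trans (L_square S); apply: card_le_prod. Qed.

Lemma card_of_code a A (P : fn -> A -> Prop) : card_le A L ->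
  (forall t, level a t -> exists r, P t r) ->
  (forall t t' r, level a t -> level a t' -> P t r -> P t' r -> agree a t t') -> level_card a.
Proof.
move=> [f fi] ex det.
case: (classic (inhabited A)) => [[r0]|nA]; last first.
  exists (fun _ => n0) => t t' /ex [r]; case: nA; exact: inhabits.
exists (fun t => f (epsilon (inhabits r0) (P t))) => t t' lt lt' /fi e.
apply: (det t t' (epsilon (inhabits r0) (P t))) => //; first by apply: epsilon_ex; apply: ex.
by rewrite e; apply: epsilon_ex; apply: ex.
Qed.

(** A node is determined by its restrictions to a cofinal set of size below cf lambda, hence by that
    many indices from [L]; moving the cofinal set into [L] along [i] makes this an element of
    [small_powers L]. *)
Lemma small_cof_card a : is_limit K a -> (forall b, b << a -> level_card b) -> small_cof a -> level_card a.
Proof.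
move=> la hcard [Y [Ya [Yc Ys]]].
have [i ii] := below_K S a.
have /fun_choice [ix ixP] : forall b : below K a, exists i : fn -> L, forall t t',
    level (proj1_sig b) t -> level (proj1_sig b) t' -> i t = i t' -> agree (proj1_sig b) t t'.
  by move=> [b ba]; apply: hcard.
pose A l := exists y, exists h : y << a, Y y /\ i (exist _ y h) = l.
have hA : forall l : {l | A l}, exists y : below K a, Y (proj1_sig y) /\ i y = proj1_sig l.
  by move=> [l [y [h [Yy e]]]]; exists (exist _ y h).
move: hA => /fun_choice [yA yAP].
have Asmall : lt_cf L {l | A l}.
  have hle : card_le {l | A l} {y | Y y}.
    exists (fun l => exist Y (proj1_sig (yA l)) (proj1 (yAP l))) => l l' [e].
    apply: sig_eq; rewrite -(proj2 (yAP l)) -(proj2 (yAP l')); f_equal; exact: sig_eq.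
  move=> Z Zc; have [h1 h2] := Ys Z Zc; split; first exact: card_le_trans h1.
  by move=> h; apply: h2; apply: card_le_trans hle.
pose code t : small_powers L := exist (fun p : { A : L -> Prop & ({x : L | A x} -> L) } =>
   lt_cf L {x : L | projT1 p x})
  (existT (fun A : L -> Prop => {x : L | A x} -> L) A (fun l => ix (yA l) t)) Asmall.
pose read (p : small_powers L) l : option L :=
  match excluded_middle_informative (projT1 (proj1_sig p) l) with
  | left h => Some (projT2 (proj1_sig p) (exist _ l h)) | right _ => None end.
apply: (card_of_code a _ (fun t r => code t = r) small_pow) => [t _|t t' r lt lt' <- e].
  by exists (code t).
move=> z za; have [c [zc ca]] := proj2 la z za; have [y [Yy cy]] := Yc c ca.
have ya := Ya y Yy; have zy := lt_le_trans _ _ _ zc cy.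
pose l := i (exist _ y ya); have Al : A l by exists y, ya.
have ey : yA (exist _ l Al) = exist _ y ya by apply: ii; apply: (proj2 (yAP (exist _ l Al))).
have e' : ix (yA (exist _ l Al)) t = ix (yA (exist _ l Al)) t'.
  have := f_equal (fun p => read p l) e; rewrite /read /=.
  by case: excluded_middle_informative => // h [e2]; rewrite (proof_irrelevance _ Al h).
rewrite ey in e'; symmetry; apply: (ixP _ _ _ _ _ (eq_sym e') z zy) => /=; exact: (level_down a y).
Qed.

Lemma par_card a : card_le ((below K a * L) * ((below K a * L) * (below K a * (L * bool)))) L.
Proof.
have h1 := below_K S a; have h2 := card_le_refl L.
have h3 : card_le bool L.
  have [x [y xy]] := L_two S.
  by exists (fun b : bool => if b then x else y) => -[] [] // e; case: xy.
by do 6!apply: card_le_LL => //.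
Qed.

(** Both claims need one induction: a branch starts from an enumerated node, and a lower level has
    an enumeration only if it is nonempty and of size at most lambda. *)
Lemma level_inh_card a : inh a /\ level_card a.
Proof.
elim: (lt_wf a) => {}a _ ih.
have hi b : b << a -> inh b by move=> /ih [].
have hc b : b << a -> level_card b by move=> /ih [].
case: (classic (is_limit K a)) => [la|nla].
  split.
    have [b0 b0a] := proj1 la; pose p : par := (b0, n0, true).
    have pb0 : fst (fst p) <<= b0 by right.
    by exists (climb_at a b0 n0 p a); case: (climb_top a b0 n0 p la hi b0a (hc b0 b0a) pb0).
  case: (classic (small_cof a)) => [sc|nsc]; first exact: small_cof_card.
  have /fun_choice [ix ixP] : forall b : below K a, exists i : fn -> L, forall t t',
      level (proj1_sig b) t -> level (proj1_sig b) t' -> i t = i t' -> agree (proj1_sig b) t t'.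
    by move=> [b ba]; apply: hc.
  apply: (card_of_code a _ (fun t r => let: ((b1, i1), ((b0, v), (b2, (n, k)))) := r in
    exists s, level (proj1_sig b1) s /\ ix b1 s = i1 /\
      agree a t (splice (proj1_sig b1) s (branch (low a level) (proj1_sig b2, n, k) a (proj1_sig b0) v)))
    (par_card a)).
    move=> t; rewrite levelE => -[_ /(_ la nsc)].
    move=> [b1 [s [b0 [v [[[b2 n] k] [h1 [h2 [h3 [[_ h4] h5]]]]]]]]].
    have b2a := le_lt_trans _ _ _ h3 h2.
    by exists ((exist _ b1 h1, ix (exist _ b1 h1) s), ((exist _ b0 h2, v), (exist _ b2 b2a, (n, k)))), s.
  move=> t t' [[b1 i1] [[b0 v] [b2 [n k]]]] _ _ [s [ls [is_ ts]]] [s' [ls' [is' ts']]].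
  have ss : agree (proj1_sig b1) s s' by apply: ixP => //; rewrite is_ is'.
  move=> z za; rewrite ts // ts' //; case: (lt_or_le z (proj1_sig b1)) => zb.
    by rewrite !splice_lt // ss.
  by rewrite !splice_ge.
have nogen t : (forall b, b << a -> level b t) -> level a t.
  by move=> h; rewrite levelE; split=> [b ba|/nla //]; split=> //; apply: h.
case: (classic (exists b, b << a)) => [[b1 b1a]|no]; last first.
  split.
    by exists (fun _ => true); apply: nogen => b ba; case: no; exists b.
  by exists (fun _ => n0) => t t' _ _ _ z za; case: no; exists z.
have [b [ba hb]] : exists b, b << a /\ forall c, c << a -> c <<= b.
  apply: NNPP => h; apply: nla; split; first by exists b1.
  move=> b ba; apply: NNPP => h'; apply: h; exists b; split=> // c ca; apply: not_lt => bc.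
  by apply: h'; exists c.
split.
  have [t lt] := hi b ba; exists t; apply: nogen => c /hb cb; exact: level_le lt.
have [i ii] := hc b ba; have [l0 [l1 l01]] := L_two S.
have [pr pri] := L_square S.
exists (fun t => pr (i t, if t b then l1 else l0)) => t t' lt lt' /pri [e1 e2] z za.
have ag := ii t t' (level_down _ _ _ ba lt) (level_down _ _ _ ba lt') e1.
case: (hb z za) => [/ag //|->].
by move: e2; case: (t b); case: (t' b) => // e; case: l01.
Qed.

Lemma level_inh a : inh a. Proof. by case: (level_inh_card a). Qed.

Lemma enum_onto a t : level a t -> exists v, agree a (enum level a v) t.
Proof. by have [h1 h2] := level_inh_card a; have [h _] := enum_spec a h1 h2; apply: h. Qed.

Lemma enum_level a v : level a (enum level a v).
Proof. by have [h1 h2] := level_inh_card a; have [_ h] := enum_spec a h1 h2; apply: h. Qed.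

End Tree.

(** * Dense open sets contain a level *)

Section Capture.
Context {L K : WO} {X : L -> Prop} {n0 : L} (S : setting L K X n0).
Context (C : K -> K -> Prop) (HC : square_seq L K C).
Context (gs : L -> K -> K -> K * (K -> L -> Prop)).
Context (small_pow : card_le (small_powers L) L).
Hypothesis Hgs : forall q, n0 <<= q -> forall (Z : K -> L -> Prop) (j : K -> K),
  exists a, is_limit K a /\ cf_gt a q /\ hits C (gs q) Z j a.

Local Notation level := (@level L K X n0 C gs).
Local Notation fn := (@fn K).
Local Notation climb_at := (@climb_at L K X n0 C gs).
Local Notation step := (@step L K X n0 gs).
Local Notation par := (@par L K).
Implicit Types (a b c d e z : K) (s t x : fn) (p q r : K * fn).

Let linh := level_inh S C HC gs small_pow.
Let enum1 := enum_onto S C HC gs small_pow.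
Let enum2 := enum_level S C HC gs small_pow.
Let lcard a := proj2 (level_inh_card S C HC gs small_pow a).

Definition lev p := level (fst p) (snd p).

Lemma not_small_cof a (q : L) : n0 <<= q -> is_limit K a -> cf_gt a q -> ~ @small_cof L K a.
Proof.
move=> n0q la cf [Y [Ya [Yc Ys]]].
have [|hle _] := Ys X.
  by move=> v; have [x [Xx vx]] := st_cof _ _ _ _ S v; exists x; split=> //; left.
have hA : card_le {y | Y y} (below L q).
  apply: card_le_trans hle _; apply: card_le_trans (st_small _ _ _ _ S) _; exact: below_le.
have [|b [ba hb]] := cf_gt_le a q {y | Y y} (@proj1_sig _ _) cf la hA.
  by move=> [y Yy]; apply: Ya.
have [c [bc ca]] := proj2 la b ba; have [y [Yy cy]] := Yc c ca.
exact: (le_not_lt _ _ (hb (exist _ y Yy)) (lt_le_trans _ _ _ bc cy)).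
Qed.

Lemma sealed_mono Lv A p q : node_le p q ->
  @sealed L K Lv A p -> @sealed L K Lv A q.
Proof.
move=> [h1 h2] [z [zp [v [Av h]]]]; exists z; split; first exact: le_trans h1.
by exists v; split=> //; apply: agree_trans h _; apply: agree_le h2.
Qed.

Lemma node_le_splice b s p q : node_le p q ->
  node_le (fst p, splice b s (snd p)) (fst q, splice b s (snd q)).
Proof. by move=> [h1 h2]; split=> //; apply: splice_agree_r. Qed.

Lemma try_holds Lv c (x : K) (Q : K * fn -> Prop) p :
  (exists q, @try_good K Lv c x Q p q) -> Q (@try K Lv c x Q p).
Proof.
move=> h; rewrite /try; case: excluded_middle_informative => // h'.
by case: (epsilon_ex p _ h') => _ [_ [_ []]].
Qed.

Lemma try_lt Lv c (x x' : K) (Q : K * fn -> Prop) p :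
  fst p << x' -> x <<= x' -> fst (@try K Lv c x Q p) << x'.
Proof.
move=> px xx; rewrite /try; case: excluded_middle_informative => // h'.
by case: (epsilon_ex p _ h') => _ [_ [h _]]; apply: lt_le_trans xx.
Qed.

Section Try2.
Context (Lv : K -> fn -> Prop) (c x1 x2 : K) (Q1 Q2 : K * fn -> Prop) (p : K * fn).
Hypothesis pc : fst p << c.
Hypothesis lp : Lv (fst p) (snd p).

(** Asked of every extension [q] below [x], and not of [p] alone, because the other guess may have
    been served before. *)
Definition attainable (x : K) (Q : K * fn -> Prop) :=
  forall q, node_le p q -> Lv (fst q) (snd q) -> fst q << x -> fst q << c ->
    exists r, @try_good K Lv c x Q q r.

Lemma try2_holds1 : (forall q r, node_le q r -> Q1 q -> Q1 r) -> fst p << x1 ->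
  attainable x1 Q1 -> Q1 (@try2 K Lv c x1 Q1 x2 Q2 p).
Proof.
move=> mono px at1; rewrite /try2; case: excluded_middle_informative => h.
  have [h1 [h2 h3]] := try_le Lv c x1 Q1 p pc lp.
  have [h4 _] := try_le Lv c x2 Q2 _ h2 h3; apply: mono h4 _.
  by apply: try_holds; apply: at1 => //; apply: node_le_refl.
have [h1 [h2 h3]] := try_le Lv c x2 Q2 p pc lp.
apply: try_holds; apply: at1 => //; apply: try_lt => //; left; exact: not_le.
Qed.

Lemma try2_holds2 : (forall q r, node_le q r -> Q2 q -> Q2 r) -> fst p << x2 ->
  attainable x2 Q2 -> Q2 (@try2 K Lv c x1 Q1 x2 Q2 p).
Proof.
move=> mono px at2; rewrite /try2; case: excluded_middle_informative => h.
  have [h1 [h2 h3]] := try_le Lv c x1 Q1 p pc lp.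
  by apply: try_holds; apply: at2 => //; apply: try_lt.
have [h1 [h2 h3]] := try_le Lv c x2 Q2 p pc lp.
have [h4 _] := try_le Lv c x1 Q1 _ h2 h3; apply: mono h4 _.
by apply: try_holds; apply: at2 => //; apply: node_le_refl.
Qed.

End Try2.

Context (D : K -> fn -> Prop).
Hypothesis Dext : forall a t t', agree a t t' -> D a t -> D a t'.
Hypothesis Dopen : forall a b t, b <<= a -> level a t -> D b t -> D a t.
Hypothesis Ddense : forall p, lev p -> exists q, node_le p q /\ lev q /\ D (fst q) (snd q).

Definition Dcode z v := D z (@enum L K level z v).

Definition right_guess (g : K * (K -> L -> Prop)) :=
  forall z v, snd g z v <-> z << fst g /\ Dcode z v.

Lemma D_mono p q : node_le p q -> lev q -> D (fst p) (snd p) -> D (fst q) (snd q).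
Proof. by move=> [h1 h2] lq Dp; apply: Dopen h1 lq _; apply: Dext Dp. Qed.

Lemma sealed_D c g p : right_guess g -> fst p <<= c -> lev p ->
  sealed (restr c level) (snd g) p -> D (fst p) (snd p).
Proof.
move=> hg pc lp [z [zp [v [/hg [_ Dz] h]]]]; apply: (Dopen _ z) => //; apply: Dext Dz.
by move: h; rewrite enum_restr //; apply: le_trans pc.
Qed.

(** The guess knows [D] only below [fst g], hence the strict bound on the node. *)
Lemma D_sealed c g p : right_guess g -> fst p << fst g -> fst p <<= c -> lev p ->
  D (fst p) (snd p) -> sealed (restr c level) (snd g) p.
Proof.
move=> hg pg pc lp Dp; exists (fst p); split; first by right.
have [v hv] := enum1 _ _ lp; exists v; rewrite enum_restr //; split=> //.
by apply/hg; split=> //; apply: Dext Dp; apply: agree_sym.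
Qed.

Definition D_upto b v p := forall u, u <<= v -> D (fst p) (splice b (@enum L K level b u) (snd p)).

Lemma lev_splice b s p : b <<= fst p -> level b s -> lev p -> lev (fst p, splice b s (snd p)).
Proof. exact: level_splice. Qed.

Lemma D_upto_mono b v p q : b <<= fst p -> node_le p q -> lev q -> D_upto b v p -> D_upto b v q.
Proof.
move=> bp pq lq h u uv.
apply: (D_mono (fst p, _) (fst q, _) (node_le_splice _ _ _ _ pq) _ (h u uv)).
apply: lev_splice => //; by apply: le_trans bp (proj1 pq).
Qed.

Lemma seals_upto_D c g b v p : right_guess g -> fst p <<= c -> b <<= fst p -> lev p ->
  seals_upto (restr c level) b (snd g) v p -> D_upto b v p.
Proof.
move=> hg pc bp lp h u uv; apply: (sealed_D c g (fst p, _) hg pc).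
  exact: lev_splice.
by have := h u uv; rewrite enum_restr //; apply: le_trans pc.
Qed.

Lemma D_seals_upto c g b v p : right_guess g -> fst p << fst g -> fst p <<= c -> b <<= fst p ->
  lev p -> D_upto b v p -> seals_upto (restr c level) b (snd g) v p.
Proof.
move=> hg pg pc bp lp h u uv; have bc := le_trans _ _ _ bp pc; rewrite enum_restr //.
apply: (D_sealed c g (fst p, _) hg pg pc); last exact: h.
exact: lev_splice.
Qed.

Lemma step_level (p : par) d c y : let g := gs n0 d c in right_guess g -> level d y ->
  d << fst g -> fst g << c ->
  (forall q, node_le (d, y) q -> lev q -> fst q << fst g -> exists r, node_le q r /\ lev r /\
     fst r << fst g /\ forall s, level d s -> D (fst r) (splice d s (snd r))) ->
  forall s, level d s -> D c (splice d s (step (restr c level) p d c y)).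
Proof.
move=> g hg ly dg gc hat s ls; have dc : d << c by apply: lt_trans gc.
have [h1 [h2 [h3 [h4 h5]]]] := step_le C gs p d c y (linh c) dc ly.
set m := step_mid gs (restr c level) p d c y in h1 h2 h3 h5.
have lc : level c (splice d s (step (restr c level) p d c y)).
  by apply: level_splice => //; left.
have hm : seals_level (restr c level) d (snd g) m.
  { rewrite /m; case: (p) => -[b n] k /=; apply: try2_holds1 => //.
  - by split=> //; left.
  - move=> q r qr hq s' ls'; apply: sealed_mono (hq s' ls'); exact: node_le_splice.
  - move=> q pq [_ lq] qg qc; have [r [qr [lr [rg hr]]]] := hat q pq lq qg.
    have rc : fst r << c by apply: lt_trans gc.
    exists r; split=> //; split; first by split=> //; left.
    do 2!split=> //; move=> s' [_ ls'].
    apply: (D_sealed c g (fst r, _)) => //; [by left| |exact: hr].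
    apply: lev_splice => //; exact: (le_trans _ _ _ (proj1 pq) (proj1 qr)). }
apply: (sealed_D c g (c, _) hg (le_refl c) lc).
apply: sealed_mono (hm s (conj (lt_le _ _ dc) ls)).
by apply: (node_le_splice d s m (c, _)); split=> //=; left.
Qed.

Lemma step_next b n k d c y v : let g := gs n d c in right_guess g -> level d y -> b <<= d ->
  d << fst g -> fst g << c ->
  @Xof L X k v -> ~ D_upto b v (d, y) ->
  (forall u, @Xof L X k u -> u << v -> D_upto b u (d, y)) ->
  (forall q, node_le (d, y) q -> lev q -> fst q << fst g -> exists r, node_le q r /\ lev r /\
     fst r << fst g /\ D_upto b v r) ->
  D_upto b v (c, step (restr c level) (b, n, k) d c y).
Proof.
move=> g hg ly bd dg gc Xv nv lv hat; have dc : d << c by apply: lt_trans gc.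
pose p : par := (b, n, k).
have [h1 [h2 [h3 [h4 h5]]]] := step_le C gs p d c y (linh c) dc ly.
set m := step_mid gs (restr c level) p d c y in h1 h2 h3 h5.
have bm : b <<= fst m by apply: le_trans bd (proj1 h1).
have dcl : d <<= c by left.
have iff_upto u : seals_upto (restr c level) b (snd g) u (d, y) <-> D_upto b u (d, y).
  by split; [apply: (seals_upto_D c g b u (d, y))|apply: (D_seals_upto c g b u (d, y))].
have hm : @seals_next L K X (restr c level) b k (snd g) (d, y) m.
  { rewrite /m /p /=; apply: try2_holds2 => //.
  - move=> q r qr hq w Xw nw lw u uw; apply: sealed_mono (hq w Xw nw lw u uw).
    exact: node_le_splice.
  - move=> q pq [_ lq] qg qc; have [r [qr [lr [rg hr]]]] := hat q pq lq qg.
    have rc : fst r << c by apply: lt_trans gc.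
    exists r; split=> //; split; first by split=> //; left.
    do 2!split=> //; move=> w Xw nw lw.
    (* The guess is right, so [w] and [v] are both the least open index. *)
    have -> : w = v.
      case: (lt_tot w v) => [wv|[//|vw]]; first by case: nw; apply/iff_upto; apply: lv.
      by case: nv; apply/iff_upto; apply: lw.
    apply: (D_seals_upto c g) => //; first by left.
    exact: (le_trans _ _ _ bd (le_trans _ _ _ (proj1 pq) (proj1 qr))). }
apply: (D_upto_mono b v m) => //; first by split=> //=; left.
apply: (seals_upto_D c g) => //; first by left.
apply: hm => //; first by move/iff_upto.
by move=> u Xu uv; apply/iff_upto; apply: lv.
Qed.

(** Level [a] has at most lambda nodes, so regularity bounds their witnesses. Below a closure point
    of [j] every node that has a witness has one there; this is how [attainable] is met. The bound
    [m] keeps closure points above a given start. *)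
Lemma reflect_bound A (Phi : A -> K * fn -> K * fn -> Prop) (m : K) : card_le A L ->
  (forall i a t t' r, agree a t t' -> Phi i (a, t) r -> Phi i (a, t') r) ->
  exists j : K -> K, forall a, a << j a /\ m << j a /\
    forall i t, level a t -> (exists r, Phi i (a, t) r) -> exists r, Phi i (a, t) r /\ fst r << j a.
Proof.
move=> hA ext.
suff h : forall a, exists b, a << b /\ m << b /\
    forall i t, level a t -> (exists r, Phi i (a, t) r) -> exists r, Phi i (a, t) r /\ fst r << b.
  by move: h => /fun_choice [j jP]; exists j.
move=> a.
have /fun_choice [h hP] : forall iv : A * L, exists b,
    (exists r, Phi (fst iv) (a, @enum L K level a (snd iv)) r) ->
    exists r, Phi (fst iv) (a, @enum L K level a (snd iv)) r /\ fst r = b.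
  move=> iv; case: (classic (exists r, Phi (fst iv) (a, @enum L K level a (snd iv)) r)).
    by move=> [r hr]; exists (fst r) => _; exists r.
  by move=> nh; exists a.
have [b hb] := K_reg S _ h (card_le_LL S _ _ hA (card_le_refl L)).
have [c hc] := K_nomax S (max_wo b (max_wo a m)).
have h1 : max_wo a m << c := le_lt_trans _ _ _ (le_max_r _ _) hc.
exists c; split; first exact: (le_lt_trans _ _ _ (le_max_l _ _) h1).
split; first exact: (le_lt_trans _ _ _ (le_max_r _ _) h1).
move=> i t lt [r hr]; have [v hv] := enum1 a t lt.
have [|r' [hr' er']] := hP (i, v).
  by exists r; apply: ext hr; apply: agree_sym.
exists r'; split; first exact: ext hr'.
by rewrite er'; apply: lt_trans (hb _) _; apply: le_lt_trans hc; apply: le_max_l.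
Qed.

Lemma consec_last a b0 d c : b0 <<= d -> consec (C a) d c -> is_last (from (C a) b0) c d.
Proof.
move=> [bd|<-] [Cd [Cc [dc h]]]; split.
- by right.
- by split=> // e [->|[_ Ce]] ec; [left|apply: not_lt => de; apply: (h e)].
- by left.
- by split=> // e [->|[_ Ce]] ec; [right|apply: not_lt => de; apply: (h e)].
Qed.

Lemma consec_from a b0 d c : b0 <<= d -> consec (C a) d c -> from (C a) b0 c.
Proof. by move=> bd [_ [Cc [dc _]]]; right; split=> //; apply: le_lt_trans dc. Qed.

(* One success at a time: each good gap settles the least open index of [Y], and there are more
   good gaps than indices. *)
Lemma seal_along k (Y : L -> Prop) (q : L) b b0 x :
  n0 <<= q -> b <<= b0 -> level b0 x ->
  (forall v, Y v -> @Xof L X k v) -> (forall u v, Y v -> @Xof L X k u -> u << v -> Y u) ->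
  card_le {v | Y v} (below L q) ->
  (forall v p, Y v -> node_le (b0, x) p -> lev p ->
     (forall u, @Xof L X k u -> u << v -> D_upto b u p) ->
     exists r, node_le p r /\ lev r /\ D_upto b v r) ->
  exists r, node_le (b0, x) r /\ lev r /\ forall v, Y v -> D_upto b v r.
Proof.
move=> n0q bb0 lx YX Yi Yc H.
pose Phi (v : L) p r := (Y v /\ node_le (b0, x) p /\ forall u, @Xof L X k u -> u << v -> D_upto b u p)
  /\ b <<= fst p /\ lev p /\ node_le p r /\ lev r /\ D_upto b v r.
have [|j jP] := reflect_bound L Phi b0 (card_le_refl L).
  { move=> v a t t' r att [[h1 [[h2 h2'] h3]] [h4 [h5 [[h6 h6'] [h7 h8]]]]].
  split; first split=> //; first split.
  - by split=> //; apply: agree_trans h2' _; apply: agree_le att.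
  - move=> u Xu uv w wu; apply: Dext (h3 u Xu uv w wu); exact: splice_agree_r.
  - split=> //; split; first exact: level_ext h5.
    by split=> //; split=> //; apply: agree_trans h6'; apply: agree_sym. }
have [a [la [cfa hit]]] := Hgs q n0q Dcode j.
(* A guessed ordinal is closed under [j], whose values exceed [b0]. *)
have b0a : b0 << a.
  have [c0 c0a] := proj1 la; have [d [c [dc [_ [dx [xc [cl _]]]]]]] := hit c0 c0a.
  have [_ [h _]] := jP d; apply: lt_trans h _; apply: lt_trans (cl d dx) _.
  apply: lt_trans xc _; have [[C1 _] _] := HC a la; apply: C1; exact: (proj1 (proj2 dc)).
have [v0 hv0] := enum1 b0 x lx.
(* The node sought is one generated branch; its own guesses [gs q] are right in cofinally many gaps
   of [C a]. *)
pose p : par := (b, q, k).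
have ha b' (_ : b' << a) := linh b'.
have hb0 := lcard b0.
pose U := climb_at a b0 v0 p.
have [ltop agtop] := climb_top C HC gs a b0 v0 p la ha b0a hb0 bb0.
have Uspec c hc := climb_spec C HC gs a b0 v0 p la ha b0a hb0 bb0 c hc.
have D0 : from (C a) b0 b0 by left.
have Ubase e : from (C a) b0 e -> lev (e, U e) /\ node_le (b0, x) (e, U e) /\ b <<= e /\
    node_le (e, U e) (a, U a).
  move=> De; have ea := from_lt C HC a b0 la b0a e De; have be := from_ge C a b0 e De.
  have [_ [h1 h2]] := Uspec e (or_introl De); split; first exact: h1.
  have [_ [_ h3]] := Uspec a (or_intror eq_refl).
  split; last split; [|exact: le_trans be|by split; [left|apply: h3 => //; left]].
  split=> //=; apply: agree_trans (agree_sym _ _ _ hv0) _.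
  by have := h2 b0 D0 be; rewrite climb_base.
exists (a, U a); split; last split=> //.
  split; first by left.
  exact: agree_trans (agree_sym _ _ _ hv0) agtop.
move=> v Yv; apply: NNPP => nv.
(* The least index open at [d] belongs to [Y]: the index [v] is open at every point of the climb,
   and [Y] is closed downwards. *)
pose next d u := @Xof L X k u /\ ~ D_upto b u (d, U d) /\
  forall w, @Xof L X k w -> w << u -> D_upto b w (d, U d).
have nextP d : from (C a) b0 d -> exists u, next d u /\ Y u.
  move=> Dd; have [ld [_ [bd da]]] := Ubase d Dd.
  have nvd : ~ D_upto b v (d, U d).
    by move=> h; apply: nv; apply: D_upto_mono h.
  have [u [[Xu nu] hu]] := least (fun u => @Xof L X k u /\ ~ D_upto b u (d, U d))
    (ex_intro _ v (conj (YX v Yv) nvd)).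
  exists u; split; first split=> //; first split=> //.
    move=> w Xw wu; apply: NNPP => nw; exact: (le_not_lt _ _ (hu w (conj Xw nw)) wu).
  by case: (hu v (conj (YX v Yv) nvd)) => [uv|->] //; apply: Yi uv.
have good b1 : b1 << a -> exists d c, b1 <<= d /\ b0 <<= d /\ from (C a) b0 d /\ from (C a) b0 c /\
    forall u, next d u -> Y u -> D_upto b u (c, U c).
  move=> b1a; have [d [c [dc [hd [dg [gc [cl hg]]]]]]] := hit _ (max_lt _ _ _ b1a b0a).
  have b0d := le_trans _ _ _ (le_max_r b1 b0) hd.
  have last := consec_last a b0 d c b0d dc; have Dd := proj1 last.
  have Dc := consec_from a b0 d c b0d dc.
  exists d, c; split; first exact: (le_trans _ _ _ (le_max_l b1 b0) hd).
  do 3!split=> //; move=> u [Xu [nu lu]] Yu.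
  have [ld [b0xd [bd _]]] := Ubase d Dd.
  have ca := from_lt C HC a b0 la b0a c Dc.
  have b0c : b0 << c by case: Dc => [e|[]] //; subst; case: (le_not_lt _ _ b0d (proj1 (proj2 last))).
  rewrite /U (climb_succ C gs a b0 v0 p c d) //.
  apply: step_next => //.
  move=> r dr lr rg.
  have bxr : node_le (b0, x) r := node_le_trans _ _ _ b0xd dr.
  have lu' w : @Xof L X k w -> w << u -> D_upto b w r.
    by move=> Xw wu; apply: D_upto_mono (lu w Xw wu).
  have [_ [_ hj]] := jP (fst r).
  have [|r' [[_ [_ [_ [h1 [h2 h3]]]]] h4]] := hj u (snd r) lr.
    have [r' [h1 [h2 h3]]] := H u r Yu bxr lr lu'.
    exists r'; split=> //; split; first exact: (le_trans _ _ _ bd (proj1 dr)).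
    by case: (r) h1 lr.
  exists r'; split; first by case: (r) h1.
  by do 2!split=> //; apply: lt_trans h4 _; apply: cl.
(* [h u] is a point at which [u] is settled, if some pair of points shows [u] least open at one and
   settled at the other; otherwise [b0] serves as default. *)
have /fun_choice [h hP] : forall u : {v | Y v}, exists c, from (C a) b0 c /\
    ((exists d c, from (C a) b0 d /\ from (C a) b0 c /\ next d (proj1_sig u) /\
      D_upto b (proj1_sig u) (c, U c)) -> D_upto b (proj1_sig u) (c, U c)).
  move=> u; case: (classic (exists d c, from (C a) b0 d /\ from (C a) b0 c /\
      next d (proj1_sig u) /\ D_upto b (proj1_sig u) (c, U c))).
    by move=> [d [c [_ [Dc [_ hc]]]]]; exists c.
  by move=> nh; exists b0.
(* |Y| < cf a bounds all these points by some [e]. A good gap beyond [e] settles an index [u] that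
   is open at its lower end [d], although [h u <<= d] had settled it already. *)
have [|e [ea he]] := cf_gt_le a q _ h cfa la Yc.
  by move=> u; apply: (from_lt C HC a b0 la b0a); apply: (proj1 (hP u)).
have [d [c [ed [b0d [Dd [Dc hdc]]]]]] := good e ea.
have [u [nu Yu]] := nextP d Dd; pose u' := exist Y u Yu.
have hu : D_upto b u (h u', U (h u')).
  by apply: (proj2 (hP u')); exists d, c; do 3!split=> //; apply: hdc.
have Dh := proj1 (hP u').
have [_ [_ [bh _]]] := Ubase _ Dh; have [ld _] := Ubase _ Dd.
apply: (proj1 (proj2 nu)); apply: D_upto_mono hu => //.
have hd : h u' <<= d := le_trans _ _ _ (he u') ed.
split=> //=; have [_ [_ h3]] := Uspec d (or_introl Dd); exact: h3.
Qed.

(** The indices up to [q] number fewer than lambda, so one climb with cf a above their number can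
    treat them all. A single translate enters [D] by density. *)
Lemma seal_initial (q : L) b b0 x : b <<= b0 -> level b0 x ->
  exists r, node_le (b0, x) r /\ lev r /\ D_upto b q r.
Proof.
move=> bb0 lx; have [q1 [_ qq1]] := st_cof _ _ _ _ S q.
have [|||r [h1 [h2 h3]]] := seal_along true (fun v => v <<= q) (max_wo n0 q1) b b0 x
    (le_max_l _ _) bb0 lx (fun _ _ => I).
- by move=> u v vq _ uv; left; apply: lt_le_trans vq.
- apply: card_le_sub => v vq; apply: lt_le_trans (le_max_r _ _); exact: le_lt_trans qq1.
- move=> v p vq pp lp hv; have bp : b <<= fst p := le_trans _ _ _ bb0 (proj1 pp).
  have [[c t] [[/= h1 h2] [h3 h4]]] := Ddense _ (lev_splice b (@enum L K level b v) p bp (enum2 b v) lp).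
  pose r := (c, splice (fst p) (snd p) t).
  have pr : node_le p r by split=> //; apply: agree_sym; apply: splice_agree.
  have lr : lev r by apply: level_splice.
  exists r; do 2!split=> //; move=> u [uv|->].
    apply: (D_mono (fst p, _) (c, _) (node_le_splice _ _ _ _ pr)).
      by apply: (lev_splice b _ r) => //; apply: le_trans bp h1.
    by apply: (hv u) => //; right.
  apply: Dext h4 => z zc /=; case: (lt_or_le z (fst p)) => zp.
    rewrite -h2 //; case: (lt_or_le z b) => zb; first by rewrite !splice_lt.
    by rewrite !(splice_ge b) // splice_lt.
  by rewrite !splice_ge //; apply: le_trans zp.
- by exists r; do 2!split=> //; apply: h3; right.
Qed.

(** The second kind of climb only visits indices in [X]; each of its successes is supplied by
    [seal_initial], and as [X] is cofinal in [L] the whole level is covered. *)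
Lemma seal_whole_level b x : level b x ->
  exists r, node_le (b, x) r /\ lev r /\ forall s, level b s -> D (fst r) (splice b s (snd r)).
Proof.
move=> lx.
have [|||r [h1 [h2 h3]]] := seal_along false X n0 b b x (le_refl _) (le_refl _) lx (fun _ h => h).
- by [].
- exact: (st_small _ _ _ _ S).
- move=> v p Xv bp lp _.
  have [r [h1 [h2 h3]]] := seal_initial v b (fst p) (snd p) (proj1 bp) lp.
  by exists r; split=> //; case: (p) h1.
- exists r; do 2!split=> //; move=> s ls; have [u hu] := enum1 b s ls.
  have [v [Xv uv]] := st_cof _ _ _ _ S u.
  apply: Dext (h3 v Xv u (lt_le _ _ uv)) => z zr.
  case: (lt_or_le z b) => zb; first by rewrite !splice_lt // hu.
  by rewrite !splice_ge.
Qed.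

(** The level [a] is found from [gs n0] alone, so every node of level [a], whatever its generator,
    has a good gap of this guess beyond its [b0] and [b1]. At the upper end of the gap the node is
    one of the translates put into [D]. *)
Theorem level_captured : exists a, forall t, level a t -> D a t.
Proof.
pose Phi (_ : L) p r := node_le p r /\ lev r /\
  forall s, level (fst p) s -> D (fst r) (splice (fst p) s (snd r)).
have [k0 _] : exists c : K, True by case: (proj1 (proj1 (st_succ _ _ _ _ S))) => f _; exists (f n0).
have [|j jP] := reflect_bound L Phi k0 (card_le_refl L).
  move=> i a t t' r att [[h1 h1'] [h2 h3]]; split=> //; split=> //=.
  by apply: agree_trans h1'; apply: agree_sym.
have [a [la [cfa hit]]] := Hgs n0 (le_refl _) Dcode j.
exists a => t lt; move: (lt); rewrite levelE => -[_ /(_ la (not_small_cof a n0 (le_refl _) la cfa))].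
move=> [b1 [s [b0 [v [p [b1a [b0a [pb [[_ ls] ht]]]]]]]]].
have ha b' (_ : b' << a) := linh b'.
rewrite (branchE C gs a b0 v p b0a) in ht.
pose U := climb_at a b0 v p.
have Uspec c hc := climb_spec C HC gs a b0 v p la ha b0a (lcard b0) pb c hc.
have [d [c [dc [hd [dg [gc [cl hg]]]]]]] := hit _ (max_lt _ _ _ b1a b0a).
have b1d := le_trans _ _ _ (le_max_l b1 b0) hd.
have b0d := le_trans _ _ _ (le_max_r b1 b0) hd.
have last := consec_last a b0 d c b0d dc; have Dd := proj1 last.
have Dc := consec_from a b0 d c b0d dc; have dltc := proj1 (proj2 last).
have ca := from_lt C HC a b0 la b0a c Dc.
have b0c : b0 << c by apply: le_lt_trans dltc.
have ld : level d (U d).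
  by have [_ [h _]] := Uspec d (or_introl Dd); apply: h; apply: lt_trans ca.
have Uc : U c = step (restr c level) p d c (U d).
  by rewrite /U (climb_succ C gs a b0 v p c d).
have key : forall s', level d s' -> D c (splice d s' (U c)).
  rewrite Uc; apply: step_level => // q dq lq qg.
  have [_ [_ hj]] := jP (fst q).
  have [|r [[h1 [h2 h3]] h4]] := hj n0 (snd q) lq.
    by have [r [h1 [h2 h3]]] := seal_whole_level (fst q) (snd q) lq; exists r.
  have qr : node_le q r by case: (q) h1.
  exists r; do 2!split=> //; split; first by apply: lt_trans h4 _; apply: cl.
  move=> s' ls'.
  (* The node [r] seals all translates by the level of [q]; a translate by a node of the lower level
     [d] is one of them. *)
  have := h3 (splice d s' (snd q)) (level_splice C gs _ _ _ _ (proj1 dq) ls' lq).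
  apply: Dext; apply: splice_splice_le; first exact: (proj1 dq).
  by apply: splice_agree_r; apply: agree_sym; case: qr.
have mono := fun e De => proj2 (proj2 (Uspec e (or_introl De))).
have top := proj2 (proj2 (Uspec a (or_intror eq_refl))).
(* Since [b1 <<= d], replacing the segment below [b1] amounts to replacing the one below [d] by this
   node. *)
have ls1 : level d (splice b1 s (U d)) by apply: level_splice.
apply: (Dopen a c) => //; first by left.
apply: Dext (key _ ls1) => z zc; have za := lt_trans _ _ _ zc ca; rewrite ht //.
rewrite -(splice_agree_r b1 c s _ _ (top c Dc (lt_le _ _ ca)) z zc); case: (lt_or_le z d) => zd.
  rewrite splice_lt //; apply: (splice_agree_r b1 d) => //.
  exact: (mono c Dc d Dd (lt_le _ _ dltc)).
rewrite !splice_ge //; exact: le_trans zd.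
Qed.

End Capture.

(** * The Souslin tree *)

(** An increasing map moves no point down, as the least such point would be followed by its image;
    if [a << b], the point [a] would be moved down. *)
Lemma below_rigid (W : WO) (a b : W) (h : below W b -> below W a) :
  (forall x y, proj1_sig x << proj1_sig y -> proj1_sig (h x) << proj1_sig (h y)) -> b <<= a.
Proof.
move=> hm; apply: not_lt => ab.
pose up (x : below W a) : below W b := exist (fun z => z << b) _ (lt_trans _ _ _ (proj2_sig x) ab).
have [x [hx1 hx2]] := least (fun x => exists y, proj1_sig y = x /\ proj1_sig (h y) << x)
  (ex_intro _ a (ex_intro _ (exist (fun z => z << b) a ab) (conj eq_refl (proj2_sig (h _))))).
case: hx1 => y [ey hy]; subst x.
apply: (le_not_lt _ _ (hx2 (proj1_sig (h y)) _) hy).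
by exists (up (h y)); split=> //; apply: hm.
Qed.

Section Souslin.
Context {L K : WO} {X : L -> Prop} {n0 : L} (S : setting L K X n0).
Context (C : K -> K -> Prop) (HC : square_seq L K C).
Context (gs : L -> K -> K -> K * (K -> L -> Prop)).
Context (small_pow : card_le (small_powers L) L).
Hypothesis Hgs : forall q, n0 <<= q -> forall (Z : K -> L -> Prop) (j : K -> K),
  exists a, is_limit K a /\ cf_gt a q /\ hits C (gs q) Z j a.

Local Notation level := (@level L K X n0 C gs).
Local Notation fn := (@fn K).
Implicit Types (a b c d e z : K) (s t : fn).

Let linh := level_inh S C HC gs small_pow.

(* Values at and above the level are set to [false], so that a node determines its function. *)
Definition tree : Type := {p : K * fn | level (fst p) (snd p) /\ forall z, fst p <<= z -> snd p z = false}.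

Definition ht (u : tree) : K := fst (proj1_sig u).
Definition val (u : tree) : fn := snd (proj1_sig u).
Definition tree_lt (u v : tree) := ht u << ht v /\ agree (ht u) (val u) (val v).

Lemma val_level u : level (ht u) (val u). Proof. exact: (proj1 (proj2_sig u)). Qed.

Lemma tree_eq u v : ht u = ht v -> agree (ht u) (val u) (val v) -> u = v.
Proof.
move=> e h; apply: sig_eq; apply: injective_projections => //.
apply: functional_extensionality => z; case: (lt_or_le z (ht u)) => hz; first exact: h.
by rewrite (proj2 (proj2_sig u)) // (proj2 (proj2_sig v)) // -[fst _]e.
Qed.

Lemma node_of a t : level a t -> exists u, ht u = a /\ agree a t (val u).
Proof.
move=> lt; pose t' := splice a t (fun _ => false).
have lt' : level a t' by apply: level_ext lt; apply: agree_sym; apply: splice_agree.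
have n z : a <<= z -> t' z = false by apply: splice_ge.
exists (exist (fun p => level (fst p) (snd p) /\ forall z, fst p <<= z -> snd p z = false)
  (a, t') (conj lt' n)); split=> //; apply: agree_sym; exact: splice_agree.
Qed.

Lemma tree_lt_trans u v w : tree_lt u v -> tree_lt v w -> tree_lt u w.
Proof.
move=> [h1 h2] [h3 h4]; split; first exact: lt_trans h3.
by apply: agree_trans h2 _; apply: agree_le h4; left.
Qed.

Lemma tree_lt_irr u : ~ tree_lt u u.
Proof. by case=> /lt_irr. Qed.

Lemma same_branch u v w : ht u <<= ht w -> ht v <<= ht w ->
  agree (ht u) (val u) (val w) -> agree (ht v) (val v) (val w) ->
  tree_lt u v \/ u = v \/ tree_lt v u.
Proof.
move=> uw vw au av; case: (lt_tot (ht u) (ht v)) => [h|[h|h]].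
- left; split=> //; apply: agree_trans au _; apply: agree_sym; apply: agree_le av; by left.
- right; left; apply: tree_eq => //; apply: agree_trans au _; apply: agree_sym; by rewrite h.
- right; right; split=> //; apply: agree_trans av _; apply: agree_sym; apply: agree_le au; by left.
Qed.

Lemma tree_is_tree : is_tree tree_lt.
Proof.
split; [exact: tree_lt_trans|split; [exact: tree_lt_irr|]] => w.
split; [|split; [|split]].
- by move=> u v x; apply: tree_lt_trans.
- by move=> u; apply: tree_lt_irr.
- move=> [u [uw au]] [v [vw av]] /=.
  have [h|[h|h]] := same_branch u v w (lt_le _ _ uw) (lt_le _ _ vw) au av; [by left|right; left|by do 2 right].
  exact: sig_eq.
- have : well_founded (fun u v : {y | tree_lt y w} => ht (proj1_sig u) << ht (proj1_sig v)).
    by apply: wf_inverse_image; apply: lt_wf.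
  apply: wf_incl; by move=> u v [].
Qed.

Lemma height_ht w : height_is tree_lt K w (ht w).
Proof.
have /fun_choice [g gP] : forall b : below K (ht w), exists u : {u | tree_lt u w}, ht (proj1_sig u) = proj1_sig b.
  move=> [b bw]; have [u [hu au]] := node_of b (val w) (level_le C gs _ _ _ (lt_le _ _ bw) (val_level w)).
  have uw : tree_lt u w by split; rewrite hu //; apply: agree_sym.
  by exists (exist _ u uw).
pose f (u : {u | tree_lt u w}) : below K (ht w) :=
  exist (fun z => z << ht w) _ (proj1 (proj2_sig u)).
have iso (u v : {u | tree_lt u w}) : tree_lt (proj1_sig u) (proj1_sig v) <->
    ht (proj1_sig u) << ht (proj1_sig v).
  split; first by case.
  case: u v => u [uw au] [v [vw av]] /= h.
  by split=> //; apply: agree_trans au _; apply: agree_sym; apply: agree_le av; left.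
exists f, g; split; last split=> //; last first.
  by move=> b; apply: sig_eq; rewrite /f /= gP.
move=> u; apply: sig_eq; have := gP (f u); rewrite /f /= => e.
have [uw au] := proj2_sig u; have [vw av] := proj2_sig (g (f u)).
apply: tree_eq; first exact: e.
apply: agree_trans av _; apply: agree_sym; by rewrite e.
Qed.

Lemma height_unique w a : height_is tree_lt K w a -> ht w = a.
Proof.
have [f [g [gf [fg fm]]]] := height_ht w.
move=> [f' [g' [gf' [fg' fm']]]]; apply: le_anti.
  apply: (below_rigid K a (ht w) (fun x => f' (g x))) => x y xy.
  by apply/fm'; apply/fm; rewrite !fg.
apply: (below_rigid K (ht w) a (fun x => f (g' x))) => x y xy.
by apply/fm; apply/fm'; rewrite !fg'.
Qed.

Lemma tree_height : tree_height_is tree_lt K.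
Proof.
split; first by move=> w; exists (ht w); apply: height_ht.
move=> a; have [t lt] := linh a; have [u [<- _]] := node_of a t lt; exists u; exact: height_ht.
Qed.

(** Splicing one node below the common height maps the cone of the other onto its own, and splicing
    back is the inverse. *)
Lemma tree_homogeneous : homogeneous tree_lt K.
Proof.
move=> x y a /height_unique hx /height_unique hy.
have trans x' y' : ht x' = a -> ht y' = a -> exists f : {z | tree_lt x' z} -> {z | tree_lt y' z},
    forall u, ht (proj1_sig (f u)) = ht (proj1_sig u) /\
      forall z, val (proj1_sig (f u)) z = splice a (val y') (val (proj1_sig u)) z.
  move=> hx' hy'; apply: (fun_choice (fun u (v : {z | tree_lt y' z}) =>
     ht (proj1_sig v) = ht (proj1_sig u) /\
      forall z, val (proj1_sig v) z = splice a (val y') (val (proj1_sig u)) z)).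
  move=> [u [xu au]] /=; rewrite hx' in xu.
  have lu : level (ht u) (splice a (val y') (val u)).
    apply: level_splice; [by left|by rewrite -hy'; apply: val_level|exact: val_level].
  have nu z : ht u <<= z -> splice a (val y') (val u) z = false.
    move=> uz; rewrite splice_ge; first by left; apply: lt_le_trans uz.
    exact: (proj2 (proj2_sig u)).
  pose v : tree := exist (fun p => level (fst p) (snd p) /\ forall z, fst p <<= z -> snd p z = false)
    (ht u, splice a (val y') (val u)) (conj lu nu).
  have yv : tree_lt y' v.
    by split; rewrite hy' //; apply: agree_sym; apply: splice_agree.
  by exists (exist _ v yv).
have [f fP] := trans x y hx hy; have [g gP] := trans y x hy hx.
have back x' y' (f' : {z | tree_lt x' z} -> {z | tree_lt y' z}) (g' : {z | tree_lt y' z} -> {z | tree_lt x' z}) :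
  ht x' = a ->
  (forall u, ht (proj1_sig (f' u)) = ht (proj1_sig u) /\
      forall z, val (proj1_sig (f' u)) z = splice a (val y') (val (proj1_sig u)) z) ->
  (forall u, ht (proj1_sig (g' u)) = ht (proj1_sig u) /\
      forall z, val (proj1_sig (g' u)) z = splice a (val x') (val (proj1_sig u)) z) ->
  forall u, g' (f' u) = u.
  move=> hx' f'P g'P u; apply: sig_eq; have [h1 h2] := f'P u; have [h3 h4] := g'P (f' u).
  apply: tree_eq; first by rewrite h3.
  move=> z _; rewrite h4; case: (lt_or_le z a) => za.
    by rewrite splice_lt //; case: (proj2_sig u) => _; rewrite hx'; apply.
  by rewrite splice_ge // h2 splice_ge.
have mono x' y' (f' : {z | tree_lt x' z} -> {z | tree_lt y' z}) :
  (forall u, ht (proj1_sig (f' u)) = ht (proj1_sig u) /\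
      forall z, val (proj1_sig (f' u)) z = splice a (val y') (val (proj1_sig u)) z) ->
  forall u v, tree_lt (proj1_sig u) (proj1_sig v) -> tree_lt (proj1_sig (f' u)) (proj1_sig (f' v)).
  move=> f'P u v [h1 h2]; have [h3 h4] := f'P u; have [h5 h6] := f'P v.
  split; first by rewrite h3 h5.
  by rewrite h3 => z zu; rewrite h4 h6; apply: (splice_agree_r a (ht (proj1_sig u))).
have gf := back x y f g hx fP gP; have fg := back y x g f hy gP fP.
exists f, g; split=> //; split=> // u v; split; first exact: mono.
by move=> h; rewrite -(gf u) -(gf v); apply: mono gP _ _ h.
Qed.

(** * Antichains, chains and completeness *)

Lemma bounded_card a : card_le {u | ht u << a} L.
Proof.
have /fun_choice [i iP] : forall b, exists i : fn -> L, forall t t', level b t -> level b t' ->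
    i t = i t' -> agree b t t'.
  by move=> b; exact: (proj2 (level_inh_card S C HC gs small_pow b)).
apply: card_le_trans (card_le_LL S _ _ (below_K S a) (card_le_refl L)).
exists (fun u => (exist (fun z => z << a) (ht (proj1_sig u)) (proj2_sig u), i (ht (proj1_sig u)) (val (proj1_sig u)))).
move=> [u ua] [v va] /= [e1 e2]; apply: sig_eq => /=; apply: tree_eq => //.
apply: (iP (ht u)); [exact: val_level|rewrite e1; exact: val_level|by rewrite e2 e1].
Qed.

Lemma unbounded_of_card (P : tree -> Prop) : card_eq {u | P u} K -> forall a, exists u, P u /\ a <<= ht u.
Proof.
move=> [f [g [gf fg]]] a; apply: NNPP => hn.
apply: (proj2 (proj1 (st_succ _ _ _ _ S))); apply: card_le_trans (bounded_card a).
have h u : P u -> ht u << a by move=> Pu; apply: not_le => au; apply: hn; exists u.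
exists (fun x => exist (fun u => ht u << a) (proj1_sig (g x)) (h _ (proj2_sig (g x)))).
by move=> x y [] /sig_eq e; rewrite -(fg x) -(fg y) e.
Qed.

(** [D] holds the nodes above a member of [P] and those without an extension above one. A member
    higher than a level included in [D] extends a node of that level, which must be of the first
    kind; so it lies above another member. *)
Lemma antichain_bounded (P : tree -> Prop) : is_antichain tree_lt P ->
  exists a, forall u, P u -> ht u <<= a.
Proof.
move=> anti.
pose meets (p : K * fn) := exists u, P u /\ node_le (ht u, val u) p.
pose D a t := meets (a, t) \/ forall q, node_le (a, t) q -> level (fst q) (snd q) -> ~ meets q.
have [a ha] : exists a, forall t, level a t -> D a t.
  { apply: (level_captured S C HC gs small_pow Hgs).
  - move=> a t t' att [[u [Pu [h1 h2]]]|h]; [left|right].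
      by exists u; split=> //; split=> //=; apply: agree_trans h2 _; apply: agree_le att.
    move=> q [h1 h2]; apply: h; split=> //; exact: agree_trans att h2.
  - move=> a b t ba lt [[u [Pu [h1 h2]]]|h]; [left|right].
      by exists u; split=> //; split=> //=; apply: le_trans ba.
    move=> q [h1 h2]; apply: h; split=> /=; [exact: le_trans h1|exact: agree_le h2].
  - move=> [a t] lt; case: (classic (exists q, node_le (a, t) q /\ level (fst q) (snd q) /\ meets q)).
      by move=> [q [h1 [h2 h3]]]; exists q; split=> //; split=> //; left; case: (q) h3.
    move=> hn; exists (a, t); split; first exact: node_le_refl.
    by split=> //; right=> q h1 h2 h3; apply: hn; exists q. }
exists a => u Pu; apply: not_lt => au.
have au' := lt_le _ _ au; have lu := level_le C gs _ _ _ au' (val_level u).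
case: (ha _ lu) => [[v [Pv [/= va h]]]|h].
  have vu : ht v << ht u by apply: le_lt_trans au.
  have ne : v <> u by move=> e; subst; case: (lt_irr _ vu).
  by case: (proj1 (anti v u Pv Pu ne)).
apply: (h (ht u, val u)) => //; first exact: val_level.
by exists u; split=> //; apply: node_le_refl.
Qed.

Lemma chain_union (P : tree -> Prop) : is_chain tree_lt P ->
  exists t, forall u, P u -> agree (ht u) (val u) t.
Proof.
move=> ch.
have /fun_choice [t tP] : forall z, exists v : bool, forall u, P u -> z << ht u -> val u z = v.
  move=> z; case: (classic (exists u, P u /\ z << ht u)) => [[u [Pu zu]]|hn]; last first.
    by exists true => u Pu zu; case: hn; exists u.
  exists (val u z) => v Pv zv; case: (ch u v Pu Pv) => [[_ h]|[->|[_ h]]] //.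
    by rewrite h.
  by rewrite h.
by exists t => u Pu z zu; apply: tP.
Qed.

(** A chain of size lambda^+ has a union [t] running through all levels; nodes that leave [t]
    exactly at [a], one for each [a], form an unbounded antichain. *)
Lemma chain_small (P : tree -> Prop) : card_eq {u | P u} K -> ~ is_chain tree_lt P.
Proof.
move=> /unbounded_of_card unb /chain_union [t tP].
have lev_t a : level a t.
  have [u [Pu au]] := unb a; apply: (level_le C gs (ht u)) => //.
  apply: level_ext (val_level u); exact: tP.
pose off a : fn := splice a t (fun z => negb (t z)).
have /fun_choice [w wP] : forall a, exists u, a << ht u /\ agree (ht u) (off a) (val u).
  (* [c] is the successor of [a], where only restrictions are tested, so the function flipped at [a]
     is a node. *)
  move=> a; have [c [ac hc]] := least _ (K_nomax S a).
  have lc : level c (off a).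
    rewrite levelE; split=> [b bc|[_ lc] _].
      have ba : b <<= a by apply: not_lt => /hc /le_not_lt; apply.
      split=> //; apply: level_ext (lev_t b); apply: agree_le ba _.
      apply: agree_sym; exact: splice_agree.
    by have [d [ad /le_not_lt dc]] := lc a ac; case: dc; apply: hc.
  by have [u [hu au]] := node_of c _ lc; exists u; rewrite hu.
have [|a ha] := antichain_bounded (fun u => exists a, u = w a).
  have no a b : a << b -> ~ tree_lt (w a) (w b) /\ ~ tree_lt (w b) (w a).
    move=> ab; have [h1 h2] := wP a; have [h3 h4] := wP b.
    have neq : val (w a) a <> val (w b) a.
      rewrite -h2 // -h4; first exact: lt_trans h3.
      rewrite /off splice_ge; first by right.
      by rewrite splice_lt //; case: (t a).
    split=> -[_ h]; apply: neq; first exact: h.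
    by symmetry; apply: h; apply: lt_trans h3.
  move=> u v [a ->] [b ->] ne; case: (lt_tot a b) => [/no //|[e|/no [] //]].
  by subst; case: ne.
have [h _] := wP a; exact: (le_not_lt _ _ (ha (w a) (ex_intro _ a eq_refl)) h).
Qed.

Lemma antichain_small (P : tree -> Prop) : card_eq {u | P u} K -> ~ is_antichain tree_lt P.
Proof.
move=> /unbounded_of_card unb /antichain_bounded [a ha].
have [b ab] := K_nomax S a; have [u [Pu bu]] := unb b.
exact: (le_not_lt _ _ (ha u Pu) (lt_le_trans _ _ _ ab bu)).
Qed.

(** The heights of a short chain without a last element have a supremum of small cofinality, and
    that level contains all branches. *)
Lemma tree_complete : cf_complete tree_lt L.
Proof.
move=> P ch sm.
have above u : exists v, tree_lt u v.
  have [c uc] := K_nomax S (ht u).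
  have [t [lt at_]] := level_above C gs c (ht u) (val u) (linh c) (lt_le _ _ uc) (val_level u).
  have [v [hv av]] := node_of c t lt; exists v; split; first by rewrite hv.
  by apply: agree_trans at_ _; apply: agree_le av; left.
case: (classic (exists u, P u)) => [[u0 Pu0]|no]; last first.
  have [k0 _] : exists c : K, True by case: (proj1 (proj1 (st_succ _ _ _ _ S))) => f _; exists (f n0).
  have [t lt] := linh k0; have [u _] := node_of k0 t lt.
  by exists u => v Pv; case: no; exists v.
case: (classic (exists u, P u /\ forall v, P v -> v = u \/ tree_lt v u)) => [[u [Pu hu]]|nomax].
  have [v uv] := above u; exists v => w /hu [->|wu] //; exact: tree_lt_trans uv.
have next u : P u -> exists v, P v /\ tree_lt u v.
  move=> Pu; apply: NNPP => hn; apply: nomax; exists u; split=> // v Pv.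
  case: (ch u v Pu Pv) => [uv|[->|]]; [|by left|by right].
  by case: hn; exists v.
have PL : card_le {u | P u} L.
  have [|hle _] := sm X.
    by move=> v; have [x [Xx vx]] := st_cof _ _ _ _ S v; exists x; split=> //; left.
  apply: card_le_trans hle _; exact: card_le_sig.
have [a [ha amin]] := least _ (K_reg S _ (fun u : {u | P u} => ht (proj1_sig u)) PL).
have cof b : b << a -> exists u, P u /\ b <<= ht u.
  move=> ba; apply: NNPP => hn; apply: (le_not_lt _ _ (amin b _) ba) => -[u Pu] /=.
  by apply: not_le => bu; apply: hn; exists u.
have hta u : P u -> ht u << a by move=> Pu; apply: (ha (exist P u Pu)).
have la : is_limit K a.
  split; first by exists (ht u0); apply: hta.
  move=> b /cof [u [Pu bu]]; have [v [Pv [uv _]]] := next u Pu.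
  exists (ht v); split; [exact: le_lt_trans uv|exact: hta].
have sc : @small_cof L K a.
  { exists (fun y => exists u, P u /\ ht u = y); split; [|split].
  - by move=> y [u [Pu <-]]; apply: hta.
  - by move=> b /cof [u [Pu bu]]; exists (ht u); split=> //; exists u.
  - move=> Z Zc; have [h1 h2] := sm Z Zc.
    have hle : card_le {y | exists u, P u /\ ht u = y} {u | P u}.
      apply: card_le_trans (card_le_img _ _ (fun u : {u | P u} => ht (proj1_sig u))).
      apply: card_le_sub => y [u [Pu <-]]; by exists (exist P u Pu).
    by split; [apply: card_le_trans h1|move=> h; apply: h2; apply: card_le_trans hle]. }
have [t tP] := chain_union P ch.
have lt : level a t.
  rewrite levelE; split=> [b ba|_ /(_ sc) //]; split=> //.
  have [u [Pu bu]] := cof b ba; apply: (level_le C gs (ht u)) => //.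
  apply: level_ext (val_level u); exact: tP.
have [x [hx ax]] := node_of a t lt; exists x => u Pu; split; first by rewrite hx; apply: hta.
by apply: agree_trans (tP u Pu) _; apply: agree_le ax; left; apply: hta.
Qed.

End Souslin.

(* L represents lambda (as an initial ordinal), K represents lambda^+ *)
Theorem theoremC (L K : WO)
  (HL : singular_cardinal L)
  (HK : is_successor_cardinal L K)
  (Hsq : square L K)
  (Hpow1 : card_lt (small_powers L) (L -> L))
  (Hpow2 : card_eq (L -> L) K) :
  exists (T : Type) (lt : T -> T -> Prop),
    souslin_tree lt K /\ homogeneous lt K /\ cf_complete lt L.
Proof.
have [X [n0 [Xcof [Xsmall n0inf]]]] := small_cofinal L HL.
have S : setting L K X n0 by split=> //; case: HL => -[].
have [C HC] := Hsq.
(* Being smaller than lambda^lambda = lambda^+ means being at most lambda. *)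
have small_pow : card_le (small_powers L) L.
  have [f [g [gf fg]]] := Hpow2; apply: (lt_K_le_L S).
    by apply: card_le_trans (proj1 Hpow1) _; exists f => x y e; rewrite -(gf x) -(gf y) e.
  move=> h; apply: (proj2 Hpow1); apply: card_le_trans h.
  by exists f => x y e; rewrite -(gf x) -(gf y) e.
have /fun_choice [gs gsP] : forall q, exists g, n0 <<= q -> forall (Z : K -> L -> Prop) j,
    exists a, is_limit K a /\ cf_gt a q /\ hits C g Z j a.
  move=> q; case: (classic (n0 <<= q)) => [h|h].
    by have [g gP] := guess S C HC Hpow2 q h; exists g.
  by exists (fun _ c => (c, fun _ _ => True)) => /h.
exists (@tree L K X n0 C gs), (tree_lt C gs); split; [split; [|split]|split].
- exact: tree_is_tree.
- exact: (tree_height S C HC gs small_pow).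
- move=> P hP; split; first exact: (chain_small S C HC gs small_pow gsP).
  exact: (antichain_small S C HC gs small_pow gsP).
- exact: tree_homogeneous.
- exact: (tree_complete S C HC gs small_pow).
Qed.
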